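(* Let $G$ be a nontrivial connected finite simple graph with $m$ edges. Then $src(G)\le m-2$ if and only if $G$ is not a tree. Furthermore, $src(G)=m-2$ if and only if $G$ is a 5-cycle or $G$ belongs to one of the graph classes $\mathcal{G}_1,\mathcal{G}_2,\mathcal{G}_3$.
   Context: All graphs are finite, undirected and simple. ''Nontrivial'' for a graph or tree means having at least two vertices; a trivial tree is a single vertex. An edge-coloring of $G$ is any assignment of colors to the edges (adjacent edges may receive the same color). A path is rainbow if no two of its edges have the same color. A rainbow $u-v$ geodesic is a rainbow $u-v$ path of length $d(u,v)$, the distance between $u$ and $v$. An edge-colored connected graph is strongly rainbow connected if for every two vertices $u,v$ there exists a rainbow $u-v$ geodesic. The strong rainbow connection number $src(G)$ of a connected graph $G$ is the minimum number of colors in an edge-coloring that makes $G$ strongly rainbow connected. A unicyclic graph is a connected graph with exactly one cycle. For a unicyclic graph $G$ with cycle $C$, let $V(C)=\{v_1,\dots,v_k\}$ (so $k$ is the length of $C$), and let $\mathcal{T}_G=\{T_i:1\le i\le k\}$, where $T_i$ is the unique tree containing $v_i$ in the graph $G\setminus E(C)$ obtained from $G$ by deleting the edges of $C$. Say $T_i$ and $T_j$ are adjacent (nonadjacent) if $v_i$ and $v_j$ are adjacent (nonadjacent) in $C$. Define: $\mathcal{G}_1$: the unicyclic graphs $G$ with $k=3$ such that $\mathcal{T}_G$ contains at most two nontrivial elements; $\mathcal{G}_2$: the unicyclic graphs $G$ with $k=4$ such that $\mathcal{T}_G$ contains two nonadjacent nontrivial elements and each nontrivial element is a path, the remaining two elements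 being trivial; $\mathcal{G}_3$: the unicyclic graphs $G$ with $k=4$ such that $\mathcal{T}_G$ contains at most one nontrivial element and this nontrivial element (if it exists) is a path.
   Formalization: In the classes G_2 and G_3, ''T_i is a path'' is taken to mean a path with v_i as one of its ends; with v_i allowed as an inner vertex the claim fails, e.g. a 4-cycle with two pendant edges at one vertex has m=6 and src=3. *)

(* Defs.v *)
From HB Require Import structures.
From mathcomp Require Import all_boot.

Set Implicit Arguments.
Unset Strict Implicit.
Unset Printing Implicit Defensive.

(* A finite simple graph is a symmetric irreflexive relation [e] on a finType
   of vertices; its edges are two-element sets of vertices. *)

Section Graph.
Variables (T : finType) (e : rel T).

Definition connected : Prop := forall x y, connect e x y.

Definition edge_set : {set {set T}} :=
  [set [set x; y] | x in T, y in T & e x y].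

(* The walk x :: p is given by its start x and its tail p, as in path.v; its
   length is size p. *)
Definition walk_edges (x : T) (p : seq T) : seq {set T} :=
  pairmap (fun y z => [set y; z]) x p.

Definition walk_of_length (x y : T) (n : nat) : bool :=
  [exists p : n.-tuple T, path e x p && (last x p == y)].

(* Two vertices in the same component are joined by a path of length < #|T|,
   so the bound on the search is harmless in a connected graph. *)
Definition dist (x y : T) : nat := find (walk_of_length x y) (iota 0 #|T|).

Section Coloring.
Variables (k : nat) (c : {ffun {A : {set T} | A \in edge_set} -> 'I_k}).

Definition rainbow (x : T) (p : seq T) : bool :=
  dinjectiveb c [pred a | val a \in walk_edges x p].

Definition has_rainbow_geodesic (x y : T) : bool :=
  [exists p : (dist x y).-tuple T,
    [&& path e x p, last x p == y, uniq (x :: p) & rainbow x p]].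

Definition strongly_rainbow_connected : bool :=
  [forall x, forall y, has_rainbow_geodesic x y].

End Coloring.

Definition strong_rainbow_colorable (k : nat) : bool :=
  [exists c : {ffun {A : {set T} | A \in edge_set} -> 'I_k},
    strongly_rainbow_connected c].

(* In a connected graph #|edge_set| pairwise distinct colors always suffice,
   so the search over 0, ..., #|edge_set| succeeds and returns the minimum. *)
Definition src : nat :=
  find strong_rainbow_colorable (iota 0 #|edge_set|.+1).

Definition graph_cycle (c : seq T) : bool :=
  [&& 2 < size c, uniq c & cycle e c].

(* The same cycle is listed by several sequences (choice of a starting point
   and of a direction); its edge set determines it as a subgraph. *)
Definition cycle_edges (c : seq T) : {set {set T}} :=
  [set [set x; next c x] | x in c].

Definition tree : Prop := connected /\ ~ (exists c, graph_cycle c).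

Definition unicyclic_with (c : seq T) : Prop :=
  [/\ connected, graph_cycle c &
      forall c', graph_cycle c' -> cycle_edges c' = cycle_edges c].

Definition cycle_graph (k : nat) : Prop :=
  exists c, [/\ graph_cycle c, size c = k, forall x, x \in c &
                edge_set = cycle_edges c].

(* Adjacency in G \ E(C). *)
Definition off_cycle (c : seq T) : rel T :=
  [rel x y | e x y && ([set x; y] \notin cycle_edges c)].

(* The vertices of the tree T_i of G \ E(C) containing the vertex v = v_i of C;
   its edges are the pairs of them adjacent for [off_cycle c]. *)
Definition hanging_tree (c : seq T) (v : T) : {set T} :=
  [set x | connect (off_cycle c) v x].

Definition nontrivial_tree (c : seq T) (v : T) : bool :=
  1 < #|hanging_tree c v|.

(* The tree hanging at v is a path attached to the cycle, that is, v is one of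
   its ends.  A path having v as an inner vertex must be excluded: the 4-cycle
   with two pendant edges at the same vertex has m = 6 and src = 3 = m - 3. *)
Definition hanging_path (c : seq T) (v : T) : Prop :=
  exists p : seq T,
    [/\ uniq (v :: p), hanging_tree c v =i v :: p &
        {in hanging_tree c v &, forall x y,
           off_cycle c x y = ([set x; y] \in walk_edges v p)}].

Definition class_G1 : Prop :=
  exists c, [/\ unicyclic_with c, size c = 3 &
                #|[set v in c | nontrivial_tree c v]| <= 2].

Definition class_G2 : Prop :=
  exists c, [/\ unicyclic_with c, size c = 4 &
    exists u v,
      [/\ [/\ u \in c, v \in c, u != v & [set u; v] \notin cycle_edges c],
          nontrivial_tree c u /\ nontrivial_tree c v,
          hanging_path c u /\ hanging_path c v &
          forall w, w \in c -> w != u -> w != v -> ~~ nontrivial_tree c w]].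

Definition class_G3 : Prop :=
  exists c, [/\ unicyclic_with c, size c = 4,
                #|[set v in c | nontrivial_tree c v]| <= 1 &
                forall v, v \in c -> nontrivial_tree c v -> hanging_path c v].

End Graph.

(* Main.v *)
(* Start from a coloring with m distinct colors and merge colors.  Two edges on no
   common geodesic may share a color, which for edges ab and cd follows from the
   distances between their ends.  A shortest cycle is isometric, so its (nearly)
   antipodal edges can be merged, and so can the three edges of a triangle: a cycle
   saves two colors, and three when its length is at least 6.  When the girth is 3, 4
   or 5, an edge leaving the cycle usually allows a third merger, sometimes after
   rerouting geodesics along the other side of a 4-cycle; the graphs in which no such
   configuration occurs are the 5-cycle and the three classes.  Conversely, edges of
   an isometric subtree need distinct colors because any two of them are on a common
   geodesic, which settles trees and G1, while graphs in G2 and G3 have two vertices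
   at distance m - 2. *)

Require Import Defs.
From HB Require Import structures.
From mathcomp Require Import all_boot zify.
From Stdlib Require Import Classical.

Set Implicit Arguments.
Unset Strict Implicit.
Unset Printing Implicit Defensive.

(** * Distances and geodesics *)

(** The obstacle is girth 4. There the promising pairs of edges do lie on common geodesics, so every
    geodesic containing a merged pair needs a substitute that is free of all merged pairs, not only
    of that one. The substitutes are made to avoid a few vertices that together touch every pair. A
    third color is saved by nontrivial trees at adjacent vertices of the square, by a connection off
    the square between opposite vertices, or by a branching tree; two opposite pendant paths are
    what remains. With a triangle, either each of its vertices has a further neighbor, and these
    outer edges are merged with the opposite sides, or some vertex has degree 2. Geodesics between
    other vertices never pass through that vertex, so the rest is isometric. If the rest contains a
    cycle, this gives two mergers besides that of the two edges at the vertex; if not, the graph is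
    in G1. The 5-cycle needs a lower bound of its own: its diameter is 2, but consecutive edges must
    differ in color and an odd cycle has no such coloring with two colors. *)

Section Metric.
Variables (T : finType) (e : rel T).
Hypotheses (e_sym : symmetric e) (e_irr : irreflexive e) (e_conn : connected e).
Local Notation d := (dist e).

Lemma dist_le_path x p : path e x p -> d x (last x p) <= size p.
Proof.
move=> pth; rewrite /dist; set P := walk_of_length e x _.
(* A walk too long to be searched for is harmless: [find] never exceeds the length [#|T|] of its
   list. *)
have [lt|ge] := ltnP (size p) #|T|; last first.
  by apply: leq_trans ge; rewrite -[leqRHS](size_iota 0) find_size.
rewrite leqNgt; apply/negP => /(before_find 0); rewrite nth_iota // add0n.
by move/existsP; case; exists (in_tuple p); rewrite /= pth eqxx.
Qed.

Lemma dist_path x y : exists p, [/\ path e x p, last x p = y & size p = d x y].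
Proof.
have /connectP[p0 /shortenP[p pth upq _] ->] := e_conn x y.
have szp : size p < #|T| by rewrite -[_.+1]/(size (x :: p)) -(card_uniqP upq) max_card.
have : has (walk_of_length e x (last x p)) (iota 0 #|T|).
  apply/hasP; exists (size p); first by rewrite mem_iota.
  by apply/existsP; exists (in_tuple p); rewrite /= pth eqxx.
move=> hs; have := nth_find 0 hs; move: hs.
rewrite has_find size_iota => lt; rewrite nth_iota // add0n.
by move=> /existsP[q /andP[qp /eqP lq]]; exists q; rewrite size_tuple; split.
Qed.

Lemma dist_xx x : d x x = 0.
Proof. by apply/eqP; rewrite -leqn0; apply: (@dist_le_path x [::]). Qed.

Lemma dist_eq0 x y : (d x y == 0) = (x == y).
Proof.
apply/eqP/eqP => [d0|->]; last exact: dist_xx.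
by have [p [_ lp /eqP]] := dist_path x y; rewrite d0 => /nilP p0; rewrite -lp p0.
Qed.

Lemma dist_triangle z x y : d x y <= d x z + d z y.
Proof.
have [p [pp <- <-]] := dist_path x z; have [q [qp <- <-]] := dist_path (last x p) y.
by rewrite -size_cat -last_cat dist_le_path // cat_path pp.
Qed.

Lemma dist_sym x y : d x y = d y x.
Proof.
have P a b : d a b <= d b a.
  have [p [pp <- <-]] := dist_path b a.
  have := @dist_le_path (last b p) (rev (belast b p)).
  rewrite rev_path size_rev size_belast.
  rewrite (eq_path (e' := e)) // => /(_ pp).
  by case: p pp => [|z p] //= _; rewrite rev_cons last_rcons.
by apply/eqP; rewrite eqn_leq !P.
Qed.

Lemma dist_edge x y : e x y -> d x y = 1.
Proof.
move=> exy; apply/eqP; rewrite eqn_leq lt0n dist_eq0.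
have := @dist_le_path x [:: y]; rewrite /= exy => /(_ isT) -> /=.
by apply/eqP => xy; rewrite xy e_irr in exy.
Qed.

Lemma dist_eq1 x y : (d x y == 1) = e x y.
Proof.
apply/eqP/idP => [|/dist_edge //]; have [[|z [|? ?]] [pp <- <-]] := dist_path x y => //= _.
by move: pp; rewrite /= andbT.
Qed.

Lemma dist_gt1 x y : x != y -> ~~ e x y -> 1 < d x y.
Proof. by rewrite -dist_eq0 -dist_eq1; case: (d x y) => [|[]]. Qed.

Lemma dist_walk w m n : (forall i, m <= i < n -> e (w i) (w i.+1)) -> m <= n ->
  d (w m) (w n) <= n - m.
Proof.
elim: n => [|n IH] we le_mn; first by move: le_mn; rewrite leqn0 => /eqP ->; rewrite dist_xx.
move: le_mn; rewrite leq_eqVlt => /predU1P[->|lt_mn]; first by rewrite dist_xx.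
rewrite subSn //; apply: leq_trans (dist_triangle (w n) _ _) _.
rewrite (dist_edge (we n _)) ?ltnSn ?andbT // addn1 ltnS IH // => i /andP[? ?].
by apply: we; lia.
Qed.

(** The source of lower bounds on distances: a function that drops by at most one along each edge.
    It is applied to the position along a pendant path. *)
Lemma dist_lipschitz (f : T -> nat) x y :
  (forall a b, e a b -> f a <= (f b).+1) -> f x <= f y + d x y.
Proof.
move=> lip; have [p [pp <- <-]] := dist_path x y.
elim: p x pp => [|z p IH] x /=; first by rewrite addn0.
by move=> /andP[/lip xz /IH zp]; lia.
Qed.

(* A geodesic is encoded by a function on nat of which only the values at
   [i <= d x y] matter. *)
Definition geodesic x y (w : nat -> T) :=
  [/\ w 0 = x, w (d x y) = y & forall i, i < d x y -> e (w i) (w i.+1)].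

Definition edge_at (w : nat -> T) i := [set w i; w i.+1].

Lemma geodesic_of_path x p : path e x p -> size p = d x (last x p) ->
  geodesic x (last x p) (nth x (x :: p)).
Proof.
move=> /(pathP x) pp sz; split=> [//||i]; rewrite -sz; first exact: nth_last.
exact: pp.
Qed.

Lemma geodesic_exists x y : exists w, geodesic x y w.
Proof.
by have [p [pp <- sz]] := dist_path x y; eexists; apply: geodesic_of_path pp sz.
Qed.

Lemma geodesic_dist x y w i j : geodesic x y w -> i <= j -> j <= d x y ->
  d (w i) (w j) = j - i.
Proof.
move=> [w0 wn we] ij jn; apply/eqP; rewrite eqn_leq dist_walk //=; last first.
  by move=> k ?; apply: we; lia.
have l1 : d (w 0) (w i) <= i - 0 by apply: dist_walk => // k ?; apply: we; lia.
have l2 : d (w j) (w (d x y)) <= d x y - j by apply: dist_walk => // k ?; apply: we; lia.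
have := dist_triangle (w i) x y; have := dist_triangle (w j) (w i) y.
by rewrite w0 in l1; rewrite wn in l2; lia.
Qed.

Lemma geodesic_rev x y w : geodesic x y w -> geodesic y x (fun k => w (d x y - k)).
Proof.
move=> [w0 wn we]; split; rewrite ?subn0 // 1?dist_sym ?subnn // => i lt.
by rewrite e_sym (_ : d x y - i = (d x y - i.+1).+1) ?we; lia.
Qed.

(** A segment of a geodesic is itself geodesic, so any other geodesic between its ends has the same
    length and fits in its place. *)
Lemma geodesic_splice x y w i j g : geodesic x y w -> i <= j -> j <= d x y ->
  geodesic (w i) (w j) g ->
  geodesic x y (fun k => if k <= i then w k else if k <= j then g (k - i) else w k).
Proof.
move=> gw ij jn; have dij := geodesic_dist gw ij jn; case: gw => [w0 wn we] [g0 gn ge].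
rewrite dij in gn ge; split=> [||k kn]; first by rewrite leq0n.
  case: leqP => [ni|ni]; first by rewrite wn.
  case: leqP => [nj|nj]; rewrite ?wn // (_ : d x y = j) ?gn //; last by lia.
  by rewrite -wn; congr w; lia.
move: kn; case: (ltngtP k i) => [ki kn|ik|-> kn]; first by rewrite we.
  case: (ltngtP k j) => [kj kn|jk kn|-> kn]; first by rewrite subSn 1?ltnW // ge //; lia.
    by rewrite we.
  by rewrite gn we.
case: (ltngtP i j) ij => // [lt_ij|eq_ij] _; last by rewrite we.
by rewrite subSnn -g0 ge //; lia.
Qed.

Lemma geodesic_append x y z w : geodesic x y w -> e y z -> d x z = (d x y).+1 ->
  geodesic x z (fun k => if k <= d x y then w k else z).
Proof.
move=> [w0 wn we] eyz dz; split; rewrite ?dz ?ltnn // => i; rewrite ltnS.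
by case: (ltngtP i (d x y)) => // [lt_i|->] _; rewrite ?wn ?we.
Qed.

Lemma geodesic_inj x y w i j : geodesic x y w -> i <= d x y -> j <= d x y ->
  w i = w j -> i = j.
Proof.
move=> gw; wlog ij : i j / i <= j => [hw ni nj wij|ni nj wij].
  by have [/hw|/ltnW/hw] := leqP i j => [->//|h]; rewrite h.
by have := geodesic_dist gw ij nj; rewrite wij dist_xx; lia.
Qed.

End Metric.

(** * Merging colors *)

Lemma set2_inj (T : finType) (a b c f : T) :
  [set a; b] = [set c; f] -> a = c /\ b = f \/ a = f /\ b = c.
Proof.
move=> E; have: a \in [set c; f] by rewrite -E set21.
have: b \in [set c; f] by rewrite -E set22.
have: c \in [set a; b] by rewrite E set21.
have: f \in [set a; b] by rewrite E set22.
by rewrite !inE; do 4 case/orP=> /eqP ?; subst; auto.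
Qed.

Section Colorings.
Variables (T : finType) (e : rel T).
Hypotheses (e_sym : symmetric e) (e_irr : irreflexive e) (e_conn : connected e).
Local Notation d := (dist e).
Local Notation E := (edge_set e).

Lemma edge_setP A : reflect (exists x y, e x y /\ A = [set x; y]) (A \in E).
Proof.
apply: (iffP imset2P) => [[x y _ /[!inE] /andP[_ exy] ->]|[x [y [exy ->]]]].
  by exists x, y.
by exists x y; rewrite ?inE.
Qed.

Lemma mem_edge_set x y : ([set x; y] \in E) = e x y.
Proof.
apply/edge_setP/idP => [[a [b [eab /set2_inj[[-> ->]|[-> ->]]]]]|exy] //.
  by rewrite e_sym.
by exists x, y.
Qed.

Lemma edge_at_edge_set x y w i : geodesic e x y w -> i < d x y -> edge_at w i \in E.
Proof. by case=> _ _ we lt; rewrite mem_edge_set we. Qed.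

Lemma walk_edgesE (x : T) p :
  walk_edges x p = mkseq (edge_at (nth x (x :: p))) (size p).
Proof.
apply: (@eq_from_nth _ set0) => [|i]; rewrite size_pairmap ?size_mkseq // => lt.
by rewrite (nth_pairmap x) // nth_mkseq.
Qed.

Lemma edge_at_inj x y w i j : geodesic e x y w -> i < d x y -> j < d x y ->
  edge_at w i = edge_at w j -> i = j.
Proof.
move=> gw lti ltj /set2_inj[[/(geodesic_inj e_irr e_conn gw) + _]|[p1 p2]].
  by apply; lia.
have := geodesic_inj e_irr e_conn gw _ _ p1; have := geodesic_inj e_irr e_conn gw _ _ p2.
lia.
Qed.

(** Vertices of a geodesic are distinct anyway, so only the colors at different positions have to be
    compared. *)
Lemma has_rainbow_geodesicP k (c : {ffun {A : {set T} | A \in E} -> 'I_k}) x y :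
  has_rainbow_geodesic c x y <-> exists w, geodesic e x y w /\
    (forall i j (A B : {A : {set T} | A \in E}), i < d x y -> j < d x y ->
       val A = edge_at w i -> val B = edge_at w j -> c A = c B -> i = j).
Proof.
split=> [/existsP[p /and4P[pp /eqP lp up /dinjectiveP rp]]|[w [gw rw]]].
  have gw : geodesic e x y (nth x (x :: p)).
    have szp : size p = d x y := size_tuple p.
    by move: (tval p) lp szp pp {up rp} => q <- szq pq; apply: geodesic_of_path.
  exists (nth x (x :: p)); split => // i j A B lti ltj Ai Bj cAB.
  apply: (edge_at_inj gw) => //; rewrite -Ai -Bj; congr val; apply: rp => //.
    by rewrite inE walk_edgesE Ai; apply: map_f; rewrite mem_iota size_tuple.
  by rewrite inE walk_edgesE Bj; apply: map_f; rewrite mem_iota size_tuple.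
have [w0 wn we] := gw.
have szp : size (mkseq (w \o succn) (d x y)) == d x y by rewrite size_mkseq.
have nthp i : i <= d x y -> nth x (x :: Tuple szp) i = w i.
  by case: i => [|i] // lt; rewrite /= nth_mkseq.
apply/existsP; exists (Tuple szp); apply/and4P; split.
- apply/(pathP x) => i; rewrite size_tuple => lt.
  by rewrite -[nth _ (Tuple _) i]/(nth x (x :: Tuple szp) i.+1) !nthp ?we // ltnW.
- by rewrite (last_nth x) size_tuple nthp // wn.
- apply/(uniqP x) => i j; rewrite !inE /= size_mkseq !ltnS => ni nj.
  by rewrite !nthp // => /(geodesic_inj e_irr e_conn gw); apply.
apply/dinjectiveP => A B; rewrite !inE walk_edgesE size_tuple.
move=> /mapP[i /[!mem_iota] /= lti Ai] /mapP[j /[!mem_iota] /= ltj Bj] cAB.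
have edgeE k' : k' < d x y -> edge_at (nth x (x :: Tuple szp)) k' = edge_at w k'.
  by move=> lt; rewrite /edge_at !nthp // ltnW.
rewrite !edgeE // in Ai Bj; apply: val_inj; rewrite [LHS]Ai [RHS]Bj; congr edge_at.
exact: rw cAB.
Qed.

(** The bound on [k] keeps it within the range searched by [find]. *)
Lemma src_le k : strong_rainbow_colorable e k -> k <= #|E| -> src e <= k.
Proof.
move=> ck le; rewrite leqNgt; apply/negP => /(before_find 0).
by rewrite nth_iota // add0n ck.
Qed.

(* Recoloring [f] by [g] for each [(f, g)] in [s] loses one color per pair. *)
Definition merge (s : seq ({set T} * {set T})) (f : {set T}) :=
  last f [seq p.2 | p <- s & p.1 == f].

Lemma mergeP s f : if f \in unzip1 s then is_true ((f, merge s f) \in s) else merge s f = f.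
Proof.
rewrite /merge; case: ifPn => [/mapP[[g b] sgb /= gf]|nf].
  have: b \in [seq p.2 | p <- s & p.1 == f].
    by apply/mapP; exists (g, b) => //; rewrite mem_filter gf eqxx.
  case def_l: [seq _ | _ <- _ & _] => [//|h l] _.
  have /mapP[[g' b']] : last h l \in [seq p.2 | p <- s & p.1 == f].
    by rewrite def_l mem_last.
  by rewrite mem_filter /= => /andP[/eqP -> ?] ->.
rewrite (_ : [seq p <- s | p.1 == f] = [::]) //; apply/eqP; rewrite -[_ == _]negbK.
rewrite -has_filter; apply: contra nf => /hasP[p sp /eqP <-].
exact: map_f.
Qed.

(** The possible reasons for two different edges to have the same color after recoloring by
    [merge]. *)
Definition conflict (s : seq ({set T} * {set T})) (f g : {set T}) :=
  [\/ (f, g) \in s, (g, f) \in s | exists2 h, (f, h) \in s & (g, h) \in s].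

Lemma merge_conflict s f g : merge s f = merge s g -> f = g \/ conflict s f g.
Proof.
have := mergeP s f; have := mergeP s g.
case: ifP => _; case: ifP => _.
- by move=> sg sf E; right; constructor 3; exists (merge s g); rewrite // -E.
- by move=> sg -> E; right; constructor 2; rewrite E.
- by move=> -> sf E; right; constructor 1; rewrite -E.
by move=> -> ->; left.
Qed.

(** The colors are the edges that are not recolored. No target is a source, so [merge] maps every
    edge to one of them, and as the sources are distinct there are [#|E| - size s] of them. *)
Lemma merge_colorable s : uniq (unzip1 s) ->
    (forall f g, (f, g) \in s -> [/\ f \in E, g \in E & g \notin unzip1 s]) ->
    (forall x y, exists2 w, geodesic e x y w & forall i j,
       i < j -> j < d x y -> ~ conflict s (edge_at w i) (edge_at w j)) ->
  strong_rainbow_colorable e (#|E| - size s).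
Proof.
move=> us sE sg; pose E' := E :\: [set f in unzip1 s].
have cE' : #|E'| = #|E| - size s.
  rewrite cardsD (setIidPr _); last first.
    by apply/subsetP => f; rewrite inE => /mapP[[f' g] /sE[? _ _] ->].
  by rewrite cardsE (card_uniqP us) size_map.
have mE f : f \in E -> merge s f \in E'.
  move=> fE; have := mergeP s f; rewrite !inE; case: ifPn => [_ /sE[_ gE gs]|nf ->].
    by rewrite gs.
  by rewrite nf.
rewrite -cE'; apply/existsP.
exists [ffun A => enum_rank_in (mE _ (valP A)) (merge s (val A))].
apply/forallP => x; apply/forallP => y; apply/has_rainbow_geodesicP.
have [w gw nc] := sg x y; exists w; split=> // i j A B ni nj Ai Bj.
rewrite !ffunE => /(congr1 enum_val); rewrite !enum_rankK_in ?mE ?(valP A) ?(valP B) //.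
wlog ij : i j A B Ai Bj ni nj / i < j => [hw hm|].
  have [/hw|/hw hji|//] := ltngtP i j; first by apply; eauto.
  by apply/esym/hji; eauto.
rewrite Ai Bj => /merge_conflict[/(edge_at_inj gw)|/nc]; first by apply; lia.
by move=> /(_ ij nj).
Qed.

Lemma src_colorable : strong_rainbow_colorable e (src e).
Proof.
have cE : strong_rainbow_colorable e #|E|.
  have := @merge_colorable [::]; rewrite subn0; apply => // x y.
  have [w gw] := geodesic_exists e_conn x y; exists w => // i j _ _.
  by case=> [||[]].
have hs : has (strong_rainbow_colorable e) (iota 0 #|E|.+1).
  by apply/hasP; exists #|E| => //; rewrite mem_iota leqnn.
have := nth_find 0 hs; rewrite nth_iota ?add0n //.
by move: hs; rewrite has_find size_iota.
Qed.

Lemma src_le_merge s : uniq (unzip1 s) ->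
    (forall f g, (f, g) \in s -> [/\ f \in E, g \in E & g \notin unzip1 s]) ->
    (forall x y, exists2 w, geodesic e x y w & forall i j,
       i < j -> j < d x y -> ~ conflict s (edge_at w i) (edge_at w j)) ->
  src e + size s <= #|E|.
Proof.
move=> us sE /(merge_colorable us sE) col.
have le_s : size s <= #|E|.
  rewrite -[leqLHS](size_map fst) -(card_uniqP us); apply/subset_leq_card/subsetP => f.
  by case/mapP => [[f' g] /sE[? _ _] ->].
by have := src_le col (leq_subr _ _); lia.
Qed.

Lemma dist_le_src x y : d x y <= src e.
Proof.
have /existsP[c /forallP/(_ x)/forallP/(_ y)] := src_colorable.
case/has_rainbow_geodesicP => w [gw rw].
pose h (i : 'I_(d x y)) := c (exist (fun A => A \in E) _ (edge_at_edge_set gw (ltn_ord i))).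
suff /leq_card : injective h by rewrite !card_ord.
by move=> i j hij; apply/val_inj; apply: rw hij; rewrite ?ltn_ord.
Qed.

(** Which geodesic between [x] and [y] is rainbow depends on the coloring, hence the demand that all
    of them contain both edges. The coloring is then injective on [S]. *)
Lemma src_ge_card (S : {set {set T}}) : S \subset E ->
    {in S &, forall f g, exists x y, forall w, geodesic e x y w ->
       exists i j, [/\ i < d x y, j < d x y, edge_at w i = f & edge_at w j = g]} ->
  #|S| <= src e.
Proof.
move=> /subsetP SE hS; have /existsP[c /forallP src_c] := src_colorable.
pose h (f : {f | f \in S}) := c (exist (fun A => A \in E) _ (SE _ (valP f))).
suff /leq_card : injective h by rewrite card_sig card_ord.
move=> f g hfg; have [x [y gxy]] := hS _ _ (valP f) (valP g).
have /has_rainbow_geodesicP[w [gw rw]] := forallP (src_c x) y.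
have [i [j [ni nj Ei Ej]]] := gxy w gw.
have ij : i = j by apply: rw hfg.
by apply: val_inj; rewrite -[LHS]Ei ij.
Qed.

End Colorings.

Lemma eq_set2 (T : finType) (a b c f : T) :
  ([set a; b] == [set c; f]) = (a == c) && (b == f) || (a == f) && (b == c).
Proof.
apply/eqP/idP => [/set2_inj[[-> ->]|[-> ->]]|]; rewrite ?eqxx ?orbT //.
by case/orP=> /andP[/eqP -> /eqP ->] //; rewrite setUC.
Qed.

Lemma unzip2_inj (T1 T2 : eqType) (s : seq (T1 * T2)) x y z :
  uniq (unzip2 s) -> (x, z) \in s -> (y, z) \in s -> x = y.
Proof.
elim: s => // -[a b] s IH /= /andP[bs us]; rewrite !inE !xpair_eqE.
have notin c : (c, b) \in s -> False.
  by move=> sc; case/negP: bs; apply/mapP; exists (c, b).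
case/orP=> [/andP[/eqP -> /eqP ->]|xs]; case/orP=> [/andP[/eqP -> /eqP zb]|ys] //.
- by case/notin: ys.
- by rewrite zb in xs; case/notin: xs.
exact: IH.
Qed.

(** * Pairs of edges on no common geodesic, and exchange of geodesics *)

Section Apart.
Variables (T : finType) (e : rel T).
Hypotheses (e_sym : symmetric e) (e_irr : irreflexive e) (e_conn : connected e).
Local Notation d := (dist e).
Local Notation E := (edge_set e).

Lemma geodesic_edges x y w i j a b c f :
    geodesic e x y w -> i < j -> j < d x y ->
    edge_at w i = [set a; b] -> edge_at w j = [set c; f] ->
  exists a' b' c' f', [/\ a' = a /\ b' = b \/ a' = b /\ b' = a,
    c' = c /\ f' = f \/ c' = f /\ f' = c,
    [/\ w i = a', w i.+1 = b', w j = c' & w j.+1 = f'] &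
    [/\ d a' c' = j - i, d b' f' = j - i, d a' f' = (j - i).+1 & (d b' c').+1 = j - i]].
Proof.
move=> gw ij nj /set2_inj Ei /set2_inj Ej; exists (w i), (w i.+1), (w j), (w j.+1).
by split=> //; split; rewrite (geodesic_dist e_irr e_conn gw) //; lia.
Qed.

Lemma edge_at_rev (w : nat -> T) n i : i < n ->
  edge_at (fun k => w (n - k)) i = edge_at w (n - i.+1).
Proof. by move=> lt; rewrite /edge_at setUC subnSK. Qed.

(* Edges that are on no common geodesic may share a color. *)
Definition apart f g := forall x y w i j, geodesic e x y w -> i < j -> j < d x y ->
  ~ (edge_at w i = f /\ edge_at w j = g).

Lemma apart_sym f g : apart f g -> apart g f.
Proof.
move=> fg x y w i j gw ij nj [wi wj].
have gw' := geodesic_rev e_sym e_conn gw.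
apply: (fg y x _ (d x y - j.+1) (d x y - i.+1) gw'); try lia.
  by rewrite (dist_sym e_sym e_conn y); lia.
by rewrite !edge_at_rev ?subnSK ?subKn //; lia.
Qed.

(** On a geodesic the outer ends of two edges are farther apart by 2 than the inner ends. There are
    four choices for the outer ends, and each inequality rules out one of them. *)
Lemma apart_dist a b c f : d a c <= (d b f).+1 -> d b f <= (d a c).+1 ->
  d a f <= (d b c).+1 -> d b c <= (d a f).+1 -> apart [set a; b] [set c; f].
Proof.
move=> ? ? ? ? x y w i j gw ij nj [wi wj].
have [a' [b' [c' [f' [ab cf _ [D1 D2 D3 D4]]]]]] := geodesic_edges gw ij nj wi wj.
by case: ab cf => -[? ?] [][? ?]; subst; lia.
Qed.

(** Here every geodesic stays rainbow. Edges with a common target share a color as well, which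
    accounts for the last condition. *)
Lemma src_le_apart s : uniq (unzip1 s) ->
    (forall f g, (f, g) \in s -> [/\ f \in E, g \in E & g \notin unzip1 s]) ->
    (forall f g, (f, g) \in s -> apart f g) ->
    (forall f g h, (f, h) \in s -> (g, h) \in s -> f <> g -> apart f g) ->
  src e + size s <= #|E|.
Proof.
move=> us sE s1 s2; apply: src_le_merge => // x y.
have [w gw] := geodesic_exists e_conn x y; exists w => // i j ij nj.
case=> [/s1|/s1/apart_sym|[h wi wj]]; try by move/(_ x y w i j gw ij nj); apply.
apply: (s2 _ _ _ wi wj _ x y w i j gw ij nj) => //.
by move/(edge_at_inj e_irr e_conn gw); lia.
Qed.

(* A geodesic containing a merged pair need not be rainbow if another one between
   the same vertices is; by symmetry the pair may be assumed to occur in order. *)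
Lemma src_le_exchange s : uniq (unzip1 s) -> uniq (unzip2 s) ->
    (forall f g, (f, g) \in s -> [/\ f \in E, g \in E & g \notin unzip1 s]) ->
    (forall x y w f g i j, geodesic e x y w -> (f, g) \in s ->
       i < j -> j < d x y -> edge_at w i = f -> edge_at w j = g ->
     exists2 w', geodesic e x y w' & forall i j, i < d x y -> j < d x y ->
       (edge_at w' i, edge_at w' j) \notin s) ->
  src e + size s <= #|E|.
Proof.
move=> us1 us2 sE exch.
pose clean x y := exists2 w, geodesic e x y w & forall i j, i < d x y -> j < d x y ->
       (edge_at w i, edge_at w j) \notin s.
have clean_sym x y : clean x y -> clean y x.
  case=> w gw nc; exists (fun k => w (d x y - k)); first exact: geodesic_rev.
  rewrite (dist_sym e_sym e_conn y) => i j ni nj.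
  by rewrite !edge_at_rev // nc //; lia.
apply: src_le_merge => // x y; have [w gw] := geodesic_exists e_conn x y.
have [w' gw' nc] : clean x y.
  apply: NNPP => ncl; apply: (ncl); exists w => // i j ni nj; apply/negP => sij.
  have [ij|ji|eq_ij] := ltngtP i j.
  - by apply: ncl; apply: exch sij _ _ erefl erefl.
  - apply/ncl/clean_sym; have gw' := geodesic_rev e_sym e_conn gw.
    apply: (exch _ _ _ _ _ (d x y - i.+1) (d x y - j.+1) gw' sij); try lia.
    - by rewrite (dist_sym e_sym e_conn y); lia.
    - by rewrite edge_at_rev ?subnSK ?subKn //; lia.
    by rewrite edge_at_rev ?subnSK ?subKn //; lia.
  (* Equal positions would mean an edge recolored by itself, but no target is a source. *)
  by have [_ _ /mapP[]] := sE _ _ sij; exists (edge_at w i, edge_at w j); rewrite // eq_ij.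
exists w' => // i j ij nj; case=> [||[h]].
- by apply/negP/nc => //; lia.
- by apply/negP/nc => //; lia.
move=> si sj; suff /(edge_at_inj e_irr e_conn gw') : edge_at w' i = edge_at w' j by lia.
exact: unzip2_inj si sj.
Qed.

(** A common neighbor of [a] and [c] can only be halfway between them on a geodesic through both.
    With [b] put there, the whole geodesic is free of [u]. *)
Lemma detour x y w k a b c u : geodesic e x y w -> k.+2 <= d x y ->
    w k = a -> w k.+2 = c -> e a b -> e b c -> e a u -> e u c -> u != b ->
  exists w', [/\ geodesic e x y w', forall i, i <= d x y -> w' i <> u &
    [/\ w' k = a, w' k.+1 = b & w' k.+2 = c]].
Proof.
move=> gw kn wk wk2 eab ebc eau euc ub; pose w' i := if i == k.+1 then b else w i.
have gw' : geodesic e x y w'.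
  case: gw => [w0 wn we]; rewrite /w'; split=> [//||i ni].
    by rewrite gtn_eqF.
  rewrite eqSS; case: (eqVneq i k.+1) => [->|_].
    by rewrite -[_ == _]negbK neq_ltn ltnSn orbT /= wk2.
  by case: (eqVneq i k) => [->|_]; [rewrite wk | exact: we].
have wk' : w' k = a by rewrite /w' ltn_eqF.
have wk2' : w' k.+2 = c by rewrite /w' gtn_eqF.
exists w'; split=> [//|i ni wi|]; last by rewrite /w' eqxx; split.
have D j : j <= d x y -> d (w' i) (w' j) = if i <= j then j - i else i - j.
  move=> nj; case: leqP => ij; last rewrite (dist_sym e_sym e_conn).
    by rewrite (geodesic_dist e_irr e_conn gw').
  by rewrite (geodesic_dist e_irr e_conn gw') // ltnW.
have := D k; have := D k.+2; rewrite wk' wk2' wi (dist_edge e_irr e_conn euc).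
rewrite (dist_sym e_sym e_conn u a) (dist_edge e_irr e_conn eau) => Dk2 Dk.
have ik : i = k.+1 by move: (Dk ltac:(lia)) (Dk2 kn); do 2 case: ifP; lia.
by move: wi; rewrite /w' ik eqxx => ub'; rewrite ub' eqxx in ub.
Qed.

End Apart.

(** * Four-cycles with pendant edges *)

Ltac set2_neq := apply/eqP; move/set2_inj => [[? ?]|[? ?]]; subst; congruence.

Ltac dlia := repeat match goal with H : is_true (?f _ _) |- _ => is_var f; clear H end; lia.

Section Square.
Variables (T : finType) (e : rel T).
Hypotheses (e_sym : symmetric e) (e_irr : irreflexive e) (e_conn : connected e).
Local Notation d := (dist e).
Local Notation E := (edge_set e).

Let dS := dist_sym e_sym e_conn.
Let d1 := dist_edge e_irr e_conn.

Lemma edge_neq x y : e x y -> x <> y.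
Proof. by move=> + xy; rewrite xy e_irr. Qed.

Lemma dist_neq x y : 0 < d x y -> x <> y.
Proof. by move=> + xy; rewrite xy dist_xx. Qed.

Lemma dist_edge_le x y z : e x y -> d x z <= (d y z).+1.
Proof. by move=> /d1 exy; have := dist_triangle e_conn y x z; rewrite exy. Qed.

Lemma geodesic_distE x y w i j : geodesic e x y w -> i <= d x y -> j <= d x y ->
  d (w i) (w j) = if i <= j then j - i else i - j.
Proof.
move=> gw ni nj; case: leqP => ij; last rewrite dS.
  by rewrite (geodesic_dist e_irr e_conn gw).
by rewrite (geodesic_dist e_irr e_conn gw) // ltnW.
Qed.

(** An induced 4-cycle. Its edges are recorded in both directions so that rotations and reflections
    merely permute the conditions. *)
Definition square v0 v1 v2 v3 :=
  [/\ e v0 v1 && e v1 v0, e v1 v2 && e v2 v1, e v2 v3 && e v3 v2, e v3 v0 && e v0 v3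
    & d v0 v2 = 2 /\ d v1 v3 = 2].

Lemma square_rot v0 v1 v2 v3 : square v0 v1 v2 v3 -> square v1 v2 v3 v0.
Proof. by case=> ? ? ? ? [? ?]; split=> //; split; rewrite // dS. Qed.

Lemma square_flip v0 v1 v2 v3 : square v0 v1 v2 v3 -> square v1 v0 v3 v2.
Proof. by case=> ? ? ? ? [? ?]; split; rewrite 1?andbC. Qed.

Lemma square_neq v0 v1 v2 v3 : square v0 v1 v2 v3 ->
  [/\ v0 <> v1, v1 <> v2, v2 <> v3, v3 <> v0 & v0 <> v2 /\ v1 <> v3].
Proof.
by case=> /andP[] /edge_neq ? _ /andP[] /edge_neq ? _ /andP[] /edge_neq ? _
  /andP[] /edge_neq ? _ [D1 D2]; do 2 split=> //; apply: dist_neq; rewrite ?D1 ?D2.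
Qed.

Lemma square_dist v0 v1 v2 v3 : square v0 v1 v2 v3 ->
  [/\ d v0 v1 = 1, d v1 v2 = 1, d v2 v3 = 1, d v3 v0 = 1 & d v0 v2 = 2 /\ d v1 v3 = 2].
Proof. by case=> /andP[/d1 ? _] /andP[/d1 ? _] /andP[/d1 ? _] /andP[/d1 ? _]. Qed.

Lemma square_apart v0 v1 v2 v3 : square v0 v1 v2 v3 -> apart e [set v0; v1] [set v2; v3].
Proof.
move/square_dist=> [D01 D12 D23 D30 [D02 D13]].
by apply: apart_dist; rewrite // ?(dS v0 v3) ?D02 ?D13 ?D30 ?D12.
Qed.

Definition meets (U : seq T) (p : {set T} * {set T}) :=
  has (fun u => (u \in p.1) || (u \in p.2)) U.

(** All merged pairs are excluded at once through vertices: a pair cannot be on a geodesic that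
    avoids an end of one of its two edges. *)
Lemma notin_avoid (s : seq ({set T} * {set T})) (U : seq T) w n i j :
    (forall k, k <= n -> w k \notin U) ->
    all (meets U) s ->
  i < n -> j < n -> (edge_at w i, edge_at w j) \notin s.
Proof.
move=> wU sU ni nj; apply/negP => /(allP sU)/hasP[u uU] /=.
by rewrite /edge_at !inE => /orP[] /orP[] /eqP wu; move: uU; rewrite wu; apply/negP/wU; dlia.
Qed.

(* The geodesic runs through u v0 v1 v2 and may use u v0 v3 v2 instead. *)
Lemma square_pendant_detour v0 v1 v2 v3 u x y w i j : square v0 v1 v2 v3 ->
    e u v0 -> u <> v1 -> geodesic e x y w -> i < j -> j < d x y ->
    edge_at w i = [set u; v0] -> edge_at w j = [set v1; v2] ->
  exists2 w', geodesic e x y w' & forall k, k <= d x y -> w' k \notin [:: v1].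
Proof.
move=> sq eu0 u1 gw ij nj wi wj; have du1 : 0 < d u v1.
  by rewrite lt0n dist_eq0 //; apply/eqP.
have [D01 D12 D23 D30 [D02 D13]] := square_dist sq.
have := d1 eu0; rewrite dS => D0u.
have [a' [b' [c' [f' [ab cf]]]]] := geodesic_edges e_irr e_conn gw ij nj wi wj.
(* Only the order [u], [v0], [v1], [v2] agrees with the distances in the square. *)
case: ab cf => -[? ?] [][? ?] [wia wib wja wjb] [E1 E2 E3 E4]; subst a' b' c' f';
  [|dlia|dlia|dlia].
have j2 : j = i.+2 by dlia.
subst j; case: sq => /andP[e01 e10] /andP[e12 e21] /andP[e23 e32] /andP[e30 e03] _.
have [|w' [gw' w'v1 _]] := detour e_sym e_irr e_conn gw nj wib wjb e03 e32 e01 e12.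
  by apply/eqP => v13; rewrite v13 dist_xx in D13.
by exists w' => // k /w'v1 wk; rewrite inE; apply/eqP.
Qed.

(** Each outer edge is merged with a side of the square beyond the adjacent vertex, and [v0 v1] with
    its opposite side. A geodesic through [u v0 v1 v2] is rerouted around [v1], one through
    [w v1 v0 v3] around [v0], and either vertex touches all three pairs. *)
Lemma src_square_adjacent v0 v1 v2 v3 u w : square v0 v1 v2 v3 ->
  e u v0 -> u <> v1 -> u <> v3 -> e w v1 -> w <> v0 -> w <> v2 -> src e + 3 <= #|E|.
Proof.
move=> sq eu0 u1 u3 ew1 w0 w2.
have [n01 n12 n23 n30 [n02 n13]] := square_neq sq.
have [/andP[e01 e10] /andP[e12 e21] /andP[e23 e32] /andP[e30 e03] _] := sq.
pose s := [:: ([set u; v0], [set v1; v2]); ([set w; v1], [set v0; v3]);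
              ([set v0; v1], [set v2; v3])].
apply: (@src_le_exchange _ _ e_sym e_irr e_conn s).
- by rewrite /= !inE !negb_or andbT; repeat (apply/andP; split); set2_neq.
- by rewrite /= !inE !negb_or andbT; repeat (apply/andP; split); set2_neq.
- move=> f g; rewrite /= !inE !xpair_eqE => /or3P[] /andP[/eqP -> /eqP ->];
  rewrite !mem_edge_set // !negb_or; (split=> //; repeat (apply/andP; split); set2_neq).
move=> x y z f g i j gz sfg ij nj zi zj.
move: sfg zi zj; rewrite /= !inE !xpair_eqE => /or3P[] /andP[/eqP-> /eqP->] zi zj.
- have [z' gz' z'U] := square_pendant_detour sq eu0 u1 gz ij nj zi zj.
  by exists z' => // k l; apply: notin_avoid z'U _; rewrite /meets /= !inE !eqxx !orbT.
- have [z' gz' z'U] := square_pendant_detour (square_flip sq) ew1 w0 gz ij nj zi zj.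
  by exists z' => // k l; apply: notin_avoid z'U _; rewrite /meets /= !inE !eqxx !orbT.
by case: (square_apart sq gz ij nj).
Qed.

(* With [t] joined to the square through [v0], two branches at [t] lead away from it.
   Their edges are on no common geodesic to the square, so they can lend their
   colors to v1 v2 and v3 v2; this is where non-path trees save a color. *)
Definition branching v0 v1 v3 t x1 x2 :=
  [/\ [/\ e x1 t, e x2 t & x1 <> x2],
      d t v0 < d x1 v1 /\ d t v0 < d x2 v1 & d t v0 < d x1 v3 /\ d t v0 < d x2 v3].

(** From [t] on, the geodesic is led to [v2] through [v3]. The distances of [v1] from [t], [v3] and
    [v2] then fit no position, and [x2] could only be the step after [t] towards [v3], but it is too
    far from [v3] for that. *)
Lemma branching_detour v0 v1 v2 v3 t x1 x2 x y w i j : square v0 v1 v2 v3 ->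
    branching v0 v1 v3 t x1 x2 ->
    d t v1 = (d t v0).+1 -> d t v3 = (d t v0).+1 -> d t v2 = (d t v0).+2 ->
    geodesic e x y w -> i < j -> j < d x y ->
    edge_at w i = [set x1; t] -> edge_at w j = [set v1; v2] ->
  exists2 w', geodesic e x y w' & forall k, k <= d x y -> w' k \notin [:: v1; x2].
Proof.
move=> sq [[ex1 ex2 nx] [lt11 lt21] [lt13 lt23]] t1 t3 t2 gw ij nj wi wj.
have [D01 D12 D23 D30 [D02 D13]] := square_dist sq.
have [/andP[e01 e10] /andP[e12 e21] /andP[e23 e32] /andP[e30 e03] _] := sq.
have := d1 ex1; have := dist_edge_le x1 e12.
have [a' [b' [c' [f' [ab cf]]]]] := geodesic_edges e_irr e_conn gw ij nj wi wj.
rewrite !(dS _ x1).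
case: ab cf => -[? ?] [][? ?] [wia wib wja wjb] [E1 E2 E3 E4] x12 xt; subst a' b' c' f';
  [|dlia|dlia|dlia].
have [g gg] := geodesic_exists e_conn t v3.
have [g0 g3 _] := gg.
have D3 : d t v2 = (d t v3).+1 by dlia.
have := geodesic_append gg e32 D3; rewrite -wib -wjb => gg2.
have lt_ij : i.+1 <= j.+1 by dlia.
have gw' := geodesic_splice e_irr e_conn gw lt_ij nj gg2.
set w' := (w' in geodesic e x y w') in gw'.
have w'i : w' i = x1 by rewrite /w' leqnSn wia.
have w'i1 : w' i.+1 = t by rewrite /w' leqnn wib.
have w'j : w' j = v3.
  rewrite /w' ifF ?leqnSn; last dlia.
  by rewrite wib (_ : j - i.+1 = d t v3) ?leqnn //; dlia.
have w'j1 : w' j.+1 = v2.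
  by rewrite /w' ifF ?leqnn /= ?wib ?ifF //; dlia.
exists w' => // k nk; have D l := geodesic_distE gw' (i := k) (j := l) nk.
have := D i ltac:(dlia); have := D i.+1 ltac:(dlia); have := D j ltac:(dlia); have := D j.+1 nj.
rewrite w'i w'i1 w'j w'j1 !inE => Dj1 Dj Di1 Di; apply/negP.
case/orP=> /eqP wk; rewrite wk in Dj1 Dj Di1 Di.
  move: Dj1 Dj Di1; rewrite (dS v1 t) D12 D13 t1; do 3 case: ifP => ?; dlia.
have nx0 : 0 < d x2 x1 by rewrite lt0n dist_eq0 //; apply/eqP => /esym.
by rewrite (d1 ex2) in Di1; move: Dj Di Di1; do 3 case: ifP => ?; dlia.
Qed.

Lemma src_square_branching v0 v1 v2 v3 t x1 x2 : square v0 v1 v2 v3 ->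
    branching v0 v1 v3 t x1 x2 ->
    d t v1 = (d t v0).+1 -> d t v3 = (d t v0).+1 -> d t v2 = (d t v0).+2 ->
  src e + 3 <= #|E|.
Proof.
move=> sq br t1 t3 t2.
have [n01 n12 n23 n30 [n02 n13]] := square_neq sq.
have [/andP[e01 e10] /andP[e12 e21] /andP[e23 e32] /andP[e30 e03] _] := sq.
have [[ex1 ex2 nx] [lt11 lt21] [lt13 lt23]] := br.
have tv1 : t <> v1 by apply: dist_neq; rewrite t1.
have tv2 : t <> v2 by apply: dist_neq; rewrite t2.
have tv3 : t <> v3 by apply: dist_neq; rewrite t3.
have x1v1 : x1 <> v1 by apply: dist_neq; dlia.
have x2v1 : x2 <> v1 by apply: dist_neq; dlia.
have x1v3 : x1 <> v3 by apply: dist_neq; dlia.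
have x2v3 : x2 <> v3 by apply: dist_neq; dlia.
pose s := [:: ([set x1; t], [set v1; v2]); ([set x2; t], [set v3; v2]);
              ([set v0; v1], [set v0; v3])].
apply: (@src_le_exchange _ _ e_sym e_irr e_conn s).
- by rewrite /= !inE !negb_or andbT; repeat (apply/andP; split); set2_neq.
- by rewrite /= !inE !negb_or andbT; repeat (apply/andP; split); set2_neq.
- move=> f g; rewrite /= !inE !xpair_eqE => /or3P[] /andP[/eqP -> /eqP ->];
  rewrite !mem_edge_set // !negb_or; (split=> //; repeat (apply/andP; split); set2_neq).
move=> x y z f g i j gz sfg ij nj zi zj.
move: sfg zi zj; rewrite /= !inE !xpair_eqE => /or3P[] /andP[/eqP-> /eqP->] zi zj.
- have [z' gz' z'U] := branching_detour sq br t1 t3 t2 gz ij nj zi zj.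
  by exists z' => // k l; apply: notin_avoid z'U _; rewrite /meets /= !inE !eqxx !orbT.
- have sq' := square_rot (square_flip sq).
  have br' : branching v0 v3 v1 t x2 x1 by split=> //; split=> //; apply/nesym.
  have [z' gz' z'U] := branching_detour sq' br' t3 t1 t2 gz ij nj zi zj.
  by exists z' => // k l; apply: notin_avoid z'U _; rewrite /meets /= !inE !eqxx !orbT.
have [D01 D12 D23 D30 [D02 D13]] := square_dist sq.
have [a' [b' [c' [f' [ab cf]]]]] := geodesic_edges e_irr e_conn gz ij nj zi zj.
have D00 : d v0 v0 = 0 by exact: dist_xx.
case: ab cf => -[? ?] [][? ?] [zia zib zja zjb] [E1 E2 E3 E4]; subst a' b' c' f';
  [dlia|dlia| |dlia].
have j1 : j = i.+1 by dlia.
subst j.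
(* The passage [v1 v0 v3] is replaced by [v1 v2 v3]. This also avoids [t]: being equidistant from
   [v1] and [v3], it could only be halfway between them, where [v2] is now. *)
have [|z' [gz' z'0 [z1 z2 z3]]] :=
  detour e_sym e_irr e_conn gz nj zia zjb e12 e23 e10 e03.
  exact/eqP.
exists z' => // k l; apply: (@notin_avoid _ [:: v0; t]) => [m nm|]; last first.
  by rewrite /meets /= !inE !eqxx !orbT.
rewrite !inE; apply/negP; case/orP=> /eqP zm; first exact: z'0 zm.
have D l' := geodesic_distE gz' (i := m) (j := l') nm.
have := D i ltac:(dlia); have := D i.+1 ltac:(dlia); have := D i.+2 nj.
by rewrite z1 z2 z3 zm t1 t2 t3; do 3 case: ifP => ?; dlia.
Qed.

End Square.

Lemma path_crossing (T : Type) (r : rel T) (Q : pred T) x p :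
  path r x p -> Q x -> ~~ Q (last x p) -> exists a b, [/\ r a b, Q a & ~~ Q b].
Proof.
elim: p x => [|y p IH] x /=; first by move=> _ ->.
case/andP=> rxy pp Qx nQ; have [Qy|nQy] := boolP (Q y); first exact: IH pp Qy nQ.
by exists x, y.
Qed.

(** * Triangles and pentagons with outer edges, and squares with opposite vertices joined off the
    square *)

Section TriangleTheta.
Variables (T : finType) (e : rel T).
Hypotheses (e_sym : symmetric e) (e_irr : irreflexive e) (e_conn : connected e).
Local Notation d := (dist e).
Local Notation E := (edge_set e).

Let dS := dist_sym e_sym e_conn.
Let d1 := dist_edge e_irr e_conn.

(** Each outer edge takes the color of the opposite side: [u] is at distance 1 from both [v] and
    [w], and [x] at distance 1 or 2, so the gap of 2 that a common geodesic requires does not occur.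
    The vertices [x], [y], [z] may coincide. *)
Lemma src_triangle_pendants u v w x y z :
    e u v -> e v w -> e w u -> e x u -> e y v -> e z w ->
    x <> v -> x <> w -> y <> u -> y <> w -> z <> u -> z <> v ->
  src e + 3 <= #|E|.
Proof.
move=> uv vw wu xu yv zw xv xw yu yw zu zv.
have nuv := edge_neq e_irr uv; have nvw := edge_neq e_irr vw; have nwu := edge_neq e_irr wu.
pose s := [:: ([set x; u], [set v; w]); ([set y; v], [set w; u]); ([set z; w], [set u; v])].
have ap a b c f : e a b -> e b c -> e c f -> e f b -> a <> c -> a <> f ->
    apart e [set a; b] [set c; f].
  move=> ab bc cf fb ac af; have := d1 bc; have := d1 fb; rewrite (dS f) => Df Dc.
  have := dist_edge_le e_irr e_conn c ab; have := dist_edge_le e_irr e_conn f ab.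
  have Pc : 0 < d a c by rewrite lt0n dist_eq0 //; apply/eqP.
  have Pf : 0 < d a f by rewrite lt0n dist_eq0 //; apply/eqP.
  by move=> *; apply: (apart_dist e_irr e_conn); dlia.
apply: (@src_le_apart _ _ e_sym e_irr e_conn s).
- by rewrite /= !inE !negb_or andbT; repeat (apply/andP; split); set2_neq.
- move=> f g; rewrite /= !inE !xpair_eqE => /or3P[] /andP[/eqP -> /eqP ->];
  rewrite !mem_edge_set // !negb_or; (split=> //; repeat (apply/andP; split); set2_neq).
- move=> f g; rewrite /= !inE !xpair_eqE => /or3P[] /andP[/eqP -> /eqP ->];
  by apply: ap => //; rewrite e_sym.
move=> f g h sf sg; case; apply: unzip2_inj sf sg.
by rewrite /= !inE !negb_or andbT; repeat (apply/andP; split); set2_neq.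
Qed.

(** The outer edge is merged with the side opposite to [v0], both ends of which are at distance 2
    from [v0]. The other four sides form two nonadjacent pairs. *)
Lemma src_pentagon_pendant v0 v1 v2 v3 v4 w :
    e v0 v1 -> e v1 v2 -> e v2 v3 -> e v3 v4 -> e v4 v0 ->
    [/\ d v0 v2 = 2, d v1 v3 = 2, d v2 v4 = 2, d v3 v0 = 2 & d v4 v1 = 2] ->
    e w v0 -> w \notin [:: v0; v1; v2; v3; v4] ->
  src e + 3 <= #|E|.
Proof.
move=> e01 e12 e23 e34 e40 [D02 D13 D24 D30 D41] w0.
rewrite !inE !negb_or => /and5P[_ /eqP w1 /eqP w2 /eqP w3 /eqP w4].
have [D01 D12 D23 D34 D40] := And5 (d1 e01) (d1 e12) (d1 e23) (d1 e34) (d1 e40).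
have nq a b : 0 < d a b -> a <> b by exact: dist_neq.
have [n01 n12 n23 n34 n40] : [/\ v0 <> v1, v1 <> v2, v2 <> v3, v3 <> v4 & v4 <> v0].
  by split; apply: nq; rewrite ?(D01, D12, D23, D34, D40).
have [n02 n13 n24 n30 n41] : [/\ v0 <> v2, v1 <> v3, v2 <> v4, v3 <> v0 & v4 <> v1].
  by split; apply: nq; rewrite ?(D02, D13, D24, D30, D41).
pose s := [:: ([set w; v0], [set v2; v3]); ([set v0; v1], [set v3; v4]);
              ([set v4; v0], [set v1; v2])].
apply: (@src_le_apart _ _ e_sym e_irr e_conn s).
- by rewrite /= !inE !negb_or andbT; repeat (apply/andP; split); set2_neq.
- move=> f g; rewrite /= !inE !xpair_eqE => /or3P[] /andP[/eqP -> /eqP ->];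
  rewrite !mem_edge_set // !negb_or; (split=> //; repeat (apply/andP; split); set2_neq).
- have P2 : 0 < d w v2 by rewrite lt0n dist_eq0 //; apply/eqP.
  have P3 : 0 < d w v3 by rewrite lt0n dist_eq0 //; apply/eqP.
  have := dist_edge_le e_irr e_conn v2 w0; have := dist_edge_le e_irr e_conn v3 w0.
  rewrite (dS v0 v3) => U3 U2.
  move=> f g; rewrite /= !inE !xpair_eqE => /or3P[] /andP[/eqP -> /eqP ->];
  by apply: (apart_dist e_irr e_conn);
    rewrite ?(dS v0 v3) ?(dS v0 v4) ?(dS v1 v4) ?(dS v4 v2); dlia.
move=> f g h sf sg; case; apply: unzip2_inj sf sg.
by rewrite /= !inE !negb_or andbT; repeat (apply/andP; split); set2_neq.
Qed.

Lemma dist_deg2 u v w z : (forall x, e v x = (x == u) || (x == w)) -> z != v ->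
  d v z = (minn (d u z) (d w z)).+1.
Proof.
move=> nv zv; have evu : e v u by rewrite nv eqxx.
have evw : e v w by rewrite nv eqxx orbT.
have := dist_edge_le e_irr e_conn z evu; have := dist_edge_le e_irr e_conn z evw.
have [p [pp lp <-]] := dist_path e_conn v z.
case: p pp lp => [_ /= vz|x p /= /andP[vx pp] <-]; first by rewrite vz eqxx in zv.
have := dist_le_path pp; move: vx; rewrite nv => /orP[]/eqP ->; dlia.
Qed.

Lemma dist_pred x y : 0 < d x y -> exists2 z, e z x & (d z y).+1 = d x y.
Proof.
have [p [pp <- sz]] := dist_path e_conn x y.
case: p pp sz => [|z p /= /andP[xz pp] sz _]; first by rewrite dist_xx.
exists z; first by rewrite e_sym.
have := dist_le_path pp; have := dist_edge_le e_irr e_conn (last z p) xz; dlia.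
Qed.

(* On a path from v0 to v2 that avoids v1 and v3, either some inner vertex is
   equidistant from v0 and v2, and the two edges around one closest to them are
   apart from the edges of the square opposite to them, or some edge goes from the
   side of v0 to the side of v2 and is apart from all edges of the square. *)
Lemma src_square_theta v0 v1 v2 v3 :
    square e v0 v1 v2 v3 ->
    (forall x, e v1 x = (x == v0) || (x == v2)) ->
    (forall x, e v3 x = (x == v0) || (x == v2)) ->
    connect [rel x y | [&& e x y, x \notin [:: v1; v3] & y \notin [:: v1; v3]]] v0 v2 ->
  src e + 3 <= #|E|.
Proof.
move=> sq deg1 deg3 /connectP[p pp lp].
have [n01 n12 n23 n30 [n02 n13]] := square_neq e_irr sq.
have [D01 D12 D23 D30 [D02 D13]] := square_dist e_irr e_conn sq.
have [/andP[e01 e10] /andP[e12 e21] /andP[e23 e32] /andP[e30 e03] _] := sq.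
have ap1 := square_apart e_sym e_irr e_conn sq.
have ap2 := square_apart e_sym e_irr e_conn (square_rot e_sym e_conn sq).
pose inner x := x \notin [:: v1; v3].
have dv1 x : inner x -> d v1 x = (minn (d v0 x) (d v2 x)).+1.
  by rewrite /inner !inE negb_or => /andP[? _]; apply: dist_deg2.
have dv3 x : inner x -> d v3 x = (minn (d v0 x) (d v2 x)).+1.
  by rewrite /inner !inE negb_or => /andP[_ ?]; apply: dist_deg2.
have innerP x : inner x -> x <> v1 /\ x <> v3.
  by rewrite /inner !inE negb_or => /andP[/eqP ? /eqP].
pose P := [pred x | inner x & d v0 x == d v2 x].
have [x0 Px0|no_eq] := pickP P.
- case: (arg_minnP (d v0) Px0) => x /andP[/= ix /eqP eqx] minP.
  have minx z : inner z -> d v0 z = d v2 z -> d v0 x <= d v0 z.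
    by move=> iz ez; apply: minP; rewrite /= iz ez eqxx.
  have D0x : 0 < d x v0.
    by rewrite lt0n dist_eq0 //; apply/eqP => xv; move: eqx; rewrite xv dist_xx (dS v2) D02.
  have D2x : 0 < d x v2 by rewrite dS -eqx dS.
  have [y0 ey0 Dy0] := dist_pred D0x; have [y2 ey2 Dy2] := dist_pred D2x.
  rewrite (dS x) (dS y0) in Dy0; rewrite (dS x) (dS y2) in Dy2.
  have [x1 x3] := innerP x ix.
  have iy z : e z x -> d v0 z < d v0 x \/ d v2 z < d v2 x -> inner z.
    move=> ezx lt; rewrite /inner !inE; apply/negP => /orP[]/eqP zv; rewrite zv in ezx lt.
      move: ezx; rewrite deg1 => /orP[]/eqP xv; move: lt eqx;
      rewrite xv !dist_xx ?(dS v2) ?D02; dlia.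
    move: ezx; rewrite deg3 => /orP[]/eqP xv; move: lt eqx;
    rewrite xv !dist_xx ?(dS v2) ?D02; dlia.
  have iy0 : inner y0 by apply: (iy y0 ey0); dlia.
  have iy2 : inner y2 by apply: (iy y2 ey2); dlia.
  have [y01 y03] := innerP _ iy0; have [y21 y23] := innerP _ iy2.
  have M0 := minx y0 iy0; have M2 := minx y2 iy2.
  have := dist_edge_le e_irr e_conn v2 ey0; have := dist_edge_le e_irr e_conn v0 ey2.
  rewrite e_sym in ey0; rewrite e_sym in ey2.
  have := dist_edge_le e_irr e_conn v2 ey0; have := dist_edge_le e_irr e_conn v0 ey2.
  rewrite !(dS _ v0) !(dS _ v2) => L1 L2 L3 L4.
  (* By minimality of [x], its predecessor [y0] towards [v0] is not equidistant, hence not closer to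
     [v2] than [x] is. *)
  have B0 : d v0 x <= d v2 y0 by dlia.
  have B2 : d v0 x <= d v0 y2 by dlia.
  have y02 : y0 <> y2 by move=> yy; move: B2; rewrite -yy; dlia.
  have := (dv1 x ix, dv3 x ix); have := (dv1 _ iy2, dv3 _ iy0) => -[F1 F3] [F2 F4].
  have xy0 := edge_neq e_irr ey0; have xy2 := edge_neq e_irr ey2.
  pose s := [:: ([set v0; v1], [set x; y2]); ([set v2; v3], [set x; y0]);
               ([set v1; v2], [set v3; v0])].
  apply: (@src_le_apart _ _ e_sym e_irr e_conn s).
  + by rewrite /= !inE !negb_or andbT; repeat (apply/andP; split); set2_neq.
  + move=> f g; rewrite /= !inE !xpair_eqE => /or3P[] /andP[/eqP -> /eqP ->];
    rewrite !mem_edge_set // !negb_or; (split=> //; repeat (apply/andP; split); set2_neq).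
  + move=> f g; rewrite /= !inE !xpair_eqE => /or3P[] /andP[/eqP -> /eqP ->] //;
    by apply: (apart_dist e_irr e_conn); clear - eqx Dy0 Dy2 L1 L2 L3 L4 F1 F2 F3 F4 B0 B2; dlia.
  move=> f g h sf sg; case; apply: unzip2_inj sf sg.
  by rewrite /= !inE !negb_or andbT; repeat (apply/andP; split); set2_neq.
have := path_crossing (Q := fun x => d v0 x < d v2 x) pp.
rewrite dist_xx (dS v2) D02 -lp dist_xx D02 => /(_ isT isT).
case=> x [y [/and3P[/= exy ix iy] Qx Qy]].
have [x1 x3] := innerP _ ix; have [y1 y3] := innerP _ iy.
have /negbT/eqP neq_y : (d v0 y == d v2 y) = false.
  by have := no_eq y; rewrite -[P y]/(inner y && _) (iy : inner y).
have := dist_edge_le e_irr e_conn v2 exy; have := dist_edge_le e_irr e_conn v0 exy.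
have eyx : e y x by rewrite e_sym.
have := dist_edge_le e_irr e_conn v2 eyx; have := dist_edge_le e_irr e_conn v0 eyx.
rewrite !(dS _ v0) !(dS _ v2) => L1 L2 L3 L4.
have := (dv1 x ix, dv3 x ix); have := (dv1 _ iy, dv3 _ iy) => -[F1 F3] [F2 F4].
have xy := edge_neq e_irr exy.
(* Here one color serves three edges, so [x y] must be apart from [v0 v1] as well. *)
pose s := [:: ([set v0; v1], [set v2; v3]); ([set x; y], [set v2; v3]);
             ([set v1; v2], [set v3; v0])].
(* Both distances change by at most one along [x y], and their order is reversed without ever being
   equal. *)
have N : [/\ d v0 y = (d v0 x).+1, d v2 x = (d v0 x).+1 & d v2 y = d v0 x].
  by clear - L1 L2 L3 L4 Qx Qy neq_y; split; dlia.
have [N1 N2 N3] := N.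
have apx : apart e [set x; y] [set v2; v3].
  by apply: (apart_dist e_irr e_conn); rewrite !(dS _ v2) !(dS _ v3);
    clear - N1 N2 N3 F1 F2 F3 F4; dlia.
have apx' : apart e [set v0; v1] [set x; y].
  by apply: (apart_dist e_irr e_conn); clear - N1 N2 N3 F1 F2 F3 F4; dlia.
apply: (@src_le_apart _ _ e_sym e_irr e_conn s).
- by rewrite /= !inE !negb_or andbT; repeat (apply/andP; split); set2_neq.
- move=> f g; rewrite /= !inE !xpair_eqE => /or3P[] /andP[/eqP -> /eqP ->];
  rewrite !mem_edge_set // !negb_or; (split=> //; repeat (apply/andP; split); set2_neq).
- by move=> f g; rewrite /= !inE !xpair_eqE => /or3P[] /andP[/eqP -> /eqP ->].
have n1 : [set v2; v3] <> [set v3; v0] by apply/eqP; set2_neq.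
move=> f g h; rewrite /= !inE !xpair_eqE.
case/or3P=> /andP[/eqP -> /eqP ->]; case/or3P=> /andP[/eqP -> /eqP hh] _ //.
- exact: apart_sym.
- by case: n1.
by case: n1.
Qed.

End TriangleTheta.

(** * Shortest cycles *)

Section Cycles.
Variables (T : finType) (r : rel T).
Hypotheses (r_sym : symmetric r) (r_irr : irreflexive r).

(** Induction on [p] for all [x] and [q]. A common first step is dropped. Otherwise, if the first
    vertex [a] of [p] is on the other path, that path up to [a] closes with the edge [x a]; if not,
    the edge [x a] is moved from [p] to the front of the other path, which keeps the total
    length. *)
Lemma two_paths_cycle x p q : path r x p -> path r x q ->
    uniq (x :: p) -> uniq (x :: q) -> last x p = last x q -> p <> q ->
  exists2 c, graph_cycle r c & size c <= size p + size q.
Proof.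
elim: p x q => [|a p IH] x q.
  case/lastP: q => [//|q y] _ _ _ /= /andP[+ _]; rewrite last_rcons => /[swap] <-.
  by rewrite mem_rcons mem_head.
case: q => [|b q].
  by move=> _ _ /= /andP[+ _] _ /esym => /[swap] ->; rewrite mem_last.
have [<-|ab] := eqVneq a b.
  rewrite /= => /andP[_ pp] /andP[_ pq] /andP[_ up] /andP[_ uq] lpq npq.
  have [|c cc sz] := IH a q pp pq up uq lpq; first by move=> pq'; rewrite pq' in npq.
  by exists c => //; lia.
move=> /= /andP[xa pp] /andP[xb pq] /andP[xp up] /andP[xq uq] lpq _.
have [aq|aq] := boolP (a \in b :: q).
  move: aq; rewrite inE (negbTE ab) /= => aq.
  have {xq uq} : uniq (x :: b :: q) by apply/andP; split.
  case/splitPr: aq pq {lpq} => q1 q2 pq.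
  rewrite -cat_rcons -[x :: b :: _]/((x :: b :: rcons q1 a) ++ q2) cat_uniq => /and3P[uc _ _].
  move: pq; rewrite cat_path /= => /and3P[pq1 q1a _].
  exists (x :: b :: rcons q1 a); last by rewrite /= !(size_rcons, size_cat) /=; clear; lia.
  apply/and3P; split; [by rewrite /= size_rcons | exact: uc | rewrite /=].
  by rewrite !rcons_path xb pq1 last_rcons q1a r_sym xa.
have pq' : path r a (x :: b :: q) by rewrite /= r_sym xa xb.
have uq' : uniq (a :: x :: b :: q).
  rewrite cons_uniq inE negb_or aq andbT; apply/and3P; split=> //.
  by apply: contraNneq xp => <-; rewrite mem_head.
have [p_eq|c cc sz] := IH a (x :: b :: q) pp pq' up uq' lpq.
  by move: xp; rewrite p_eq !inE eqxx orbT.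
by exists c; rewrite // addSnnS.
Qed.

Lemma shortest_cycle : (exists c, graph_cycle r c) ->
  exists2 c, graph_cycle r c & forall c', graph_cycle r c' -> size c <= size c'.
Proof.
case=> c; have [n] := ubnP (size c); elim: n c => // n IH c lt_n cc.
have [[c' [cc' lt]]|H] := classic (exists c', graph_cycle r c' /\ size c' < size c).
  by apply: IH cc'; lia.
by exists c => // c' cc'; rewrite leqNgt; apply/negP => lt; apply: H; exists c'.
Qed.

Section OneCycle.
Variables (c : seq T) (x0 : T).
Hypothesis cc : graph_cycle r c.
Local Notation n := (size c).

(** Indices are taken modulo the length, so arcs may run past the end of the list; [x0] is only a
    default value. *)
Definition cyc i := nth x0 c (i %% n).

Let n_gt2 : 2 < n. Proof. by case/and3P: cc. Qed.
Let uc : uniq c. Proof. by case/and3P: cc. Qed.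

Lemma cyc_mem i : cyc i \in c.
Proof. by rewrite mem_nth // ltn_pmod //; lia. Qed.

Lemma cycP x : x \in c -> exists2 i, i < n & cyc i = x.
Proof.
by move=> xc; exists (index x c); rewrite ?index_mem // /cyc modn_small ?index_mem ?nth_index.
Qed.

Lemma cyc_small i : i < n -> cyc i = nth x0 c i.
Proof. by move=> lt; rewrite /cyc modn_small. Qed.

Lemma cyc_add i : cyc (i + n) = cyc i.
Proof. by rewrite /cyc modnDr. Qed.

Lemma cyc_inj i j : i < n -> j < n -> cyc i = cyc j -> i = j.
Proof. by move=> li lj; rewrite !cyc_small // => /eqP; rewrite nth_uniq // => /eqP. Qed.

Lemma cyc_inj_mod i j : cyc i = cyc j -> i = j %[mod n].
Proof.
have n_gt0 : 0 < n by apply: leq_trans n_gt2.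
by move=> ij; apply: cyc_inj; rewrite ?ltn_pmod // /cyc !modn_mod; exact: ij.
Qed.

Lemma cyc_next i : next c (cyc i) = cyc i.+1.
Proof.
rewrite next_nth cyc_mem /cyc.
have lt : i %% n < n by rewrite ltn_pmod //; lia.
rewrite index_uniq // -(addn1 i) -modnDml addn1.
move: lt; move: (i %% n) => k; case: {+}c => // y c' /=.
rewrite ltnS leq_eqVlt => /predU1P[->|lt]; first by rewrite modnn nth_default.
by rewrite modn_small //=; apply: set_nth_default.
Qed.

Lemma cyc_edge i : r (cyc i) (cyc i.+1).
Proof. by rewrite -cyc_next; apply: next_cycle (cyc_mem i); case/and3P: cc. Qed.

Lemma cyc_edge_inj i j : i < n -> j < n ->
  [set cyc i; cyc i.+1] = [set cyc j; cyc j.+1] -> i = j.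
Proof.
move=> li lj /set2_inj[[/cyc_inj + _]|[/cyc_inj_mod + /cyc_inj_mod]]; first exact.
rewrite !(modn_small li) !(modn_small lj).
have S k : k < n -> k.+1 %% n = if k.+1 == n then 0 else k.+1.
  by move=> lt; case: eqP => [->|?]; rewrite ?modnn // modn_small //; lia.
by rewrite !S //; do 2 case: eqP => ?; lia.
Qed.

Lemma cyc_arc i k : path r (cyc i) [seq cyc j | j <- iota i.+1 k] /\
  last (cyc i) [seq cyc j | j <- iota i.+1 k] = cyc (i + k).
Proof.
elim: k i => [|k IH] i; first by rewrite addn0.
by have [p1 l1] := IH i.+1; rewrite /= cyc_edge p1 l1 addSnnS.
Qed.

Lemma cyc_arc_uniq i k : k < n -> uniq (cyc i :: [seq cyc j | j <- iota i.+1 k]).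
Proof.
move=> lt; rewrite -[_ :: _]/(map cyc (iota i k.+1)) map_inj_in_uniq ?iota_uniq //.
move=> a b; rewrite !mem_iota => la lb /cyc_inj_mod E.
wlog ab : a b la lb E / a <= b => [hw|].
  by have [/hw|/ltnW/hw h] := leqP a b; [apply | apply/esym/h].
have : b = a %[mod n] by [].
move/eqP; rewrite eqn_mod_dvd // => /dvdnP[m]; case: m => [|m]; first by lia.
by have := leq_pmull n (ltn0Sn m); lia.
Qed.

End OneCycle.

End Cycles.

(** * Mergers along an isometric cycle *)

Section Isometric.
Variables (T : finType) (e r : rel T).
Hypotheses (e_sym : symmetric e) (e_irr : irreflexive e) (e_conn : connected e).
Hypotheses (r_sym : symmetric r) (r_sub : subrel r e).
Local Notation d := (dist e).
Local Notation E := (edge_set e).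

Let dS := dist_sym e_sym e_conn.

Let r_irr : irreflexive r.
Proof. by move=> x; apply/negP => /r_sub; rewrite e_irr. Qed.

Variables (c : seq T) (x0 : T).
Hypotheses (cc : graph_cycle r c)
  (c_min : forall c', graph_cycle r c' -> size c <= size c')
  (c_geo : {in c &, forall x y,
     exists p, [/\ path r x p, last x p = y & size p = d x y]}).
Local Notation n := (size c).
Local Notation v := (cyc c x0).

Let n_gt2 : 2 < n. Proof. by case/and3P: cc. Qed.

(** If a geodesic between the two vertices is not the arc of length [k], the two contain a cycle of
    length at most [d + k], and minimality of [n] gives [n - k <= d]. The relation [r] is the whole
    graph or the graph without a vertex, while distances are always those of [e]. *)
Lemma cyc_dist i k : k <= n -> d (v i) (v (i + k)) = minn k (n - k).
Proof.
move=> le_k.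
have upper j l : d (v j) (v (j + l)) <= l.
  have [/(sub_path r_sub)/dist_le_path + <-] := cyc_arc x0 cc j l.
  by rewrite size_map size_iota.
have up2 : d (v i) (v (i + k)) <= n - k.
  by rewrite dS; have := upper (i + k) (n - k); rewrite -addnA subnKC // cyc_add.
have up1 := upper i k; apply/eqP; rewrite eqn_leq leq_min up1 up2 /=.
move: le_k; rewrite leq_eqVlt => /predU1P[->|lt_k]; first by rewrite subnn minn0.
have [p [pp lp sz]] := c_geo (cyc_mem x0 cc i) (cyc_mem x0 cc (i + k)).
have [p' [pp' lp' up' sz']] :
    exists p', [/\ path r (v i) p', last (v i) p' = v (i + k), uniq (v i :: p')
      & size p' <= size p].
  rewrite -lp; case/shortenP: pp => p' pp' up' sub; exists p'; split=> //.
  by case/andP: up' => _ up'; apply: uniq_leq_size.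
have [pa la] := cyc_arc x0 cc i k; have ua := cyc_arc_uniq x0 cc i lt_k.
have [Ep|/eqP np] := eqVneq p' [seq v j | j <- iota i.+1 k].
  by rewrite geq_min -sz (leq_trans _ sz') // Ep size_map size_iota.
have [|c' cc' sz2] := two_paths_cycle r_sym pp' pa up' ua _ np; first by rewrite lp' la.
have := c_min cc'; move: sz2; rewrite size_map size_iota -sz; clear - sz' lt_k.
lia.
Qed.

Lemma cyc_apart i : 3 < n ->
  apart e [set v i; v i.+1] [set v (i + n./2); v (i + n./2).+1].
Proof.
move=> n4; have K j k : k <= n -> d (v j) (v (j + k)) = minn k (n - k) by exact: cyc_dist.
have := K i n./2; have := K i n./2.+1; have := K i.+1 n./2; have := K i.+1 n./2.-1.
rewrite !addnS !addSn; have -> : (i + n./2.-1).+1 = i + n./2 by clear - n4; lia.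
move=> K1 K2 K3 K4; apply: (apart_dist e_irr e_conn); rewrite ?K1 ?K2 ?K3 ?K4;
  by clear - n4; lia.
Qed.

(* The lower bound 2 matters for triangles only: all three edges of a triangle
   may get the same color. *)
Lemma cycle_merges : exists s : seq ({set T} * {set T}),
  [/\ size s = maxn 2 n./2, uniq (unzip1 s),
      forall f g, (f, g) \in s ->
        [/\ f \in edge_set r, g \in edge_set r, g \notin unzip1 s & apart e f g] &
      forall f g h, (f, h) \in s -> (g, h) \in s -> f <> g -> apart e f g].
Proof.
pose ed i := [set v i; v i.+1].
have edE i : ed i \in edge_set r by rewrite mem_edge_set //; exact: cyc_edge cc _.
have ed_inj i j : i < n -> j < n -> ed i = ed j -> i = j by exact: (cyc_edge_inj cc).
have [n3|n4] := leqP n 3.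
  have n_eq : n = 3 by clear - n3 n_gt2; lia.
  have K k l : d (v k) (v l) <= 1.
    have Ev m : v m = v (m %% n) by rewrite /cyc modn_mod.
    wlog kl : k l / k %% n <= l %% n => [hw|].
      by have [/hw|/ltnW/hw] := leqP (k %% n) (l %% n); rewrite // dS.
    have lt_l : l %% n < n by rewrite ltn_pmod // n_eq.
    rewrite (Ev k) (Ev l) -(subnKC kl) cyc_dist; move: lt_l; rewrite n_eq; clear; lia.
  have ap i j : apart e (ed i) (ed j).
    by apply: (apart_dist e_irr e_conn); apply: leq_trans (K _ _) _.
  have neq i j : i < n -> j < n -> i != j -> (ed i == ed j) = false.
    by move=> li lj; apply: contraNF => /eqP/ed_inj ->.
  exists [:: (ed 0, ed 2); (ed 1, ed 2)]; rewrite /= !inE !neq ?n_eq //; split=> //.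
  - move=> f g; rewrite !inE !xpair_eqE => /orP[] /andP[/eqP -> /eqP ->];
    by rewrite !neq ?n_eq; split.
  - move=> f g h; rewrite !inE !xpair_eqE.
    by case/orP=> /andP[/eqP -> _]; case/orP=> /andP[/eqP -> _] _; apply: ap.
have lt_h i : i < n./2 -> i < n /\ i + n./2 < n by clear; lia.
(* For odd [n] the last edge, [ed n.-1], keeps its own color. *)
exists [seq (ed i, ed (i + n./2)) | i <- iota 0 n./2].
have u1 : unzip1 [seq (ed i, ed (i + n./2)) | i <- iota 0 n./2] = [seq ed i | i <- iota 0 n./2].
  by rewrite /unzip1 -map_comp.
rewrite u1; split.
- by rewrite size_map size_iota; clear - n4; lia.
- rewrite map_inj_in_uniq ?iota_uniq // => i j; rewrite !mem_iota /= => /lt_h[li _] /lt_h[lj _].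
  exact: ed_inj.
- move=> f g /mapP[i /[!mem_iota] /= li [-> ->]]; have [li1 li2] := lt_h i li.
  split=> //; last exact: cyc_apart.
  apply/mapP => -[j /[!mem_iota] /= lj]; have [lj1 lj2] := lt_h j lj.
  by move/ed_inj => /(_ li2 lj1); clear - li lj; lia.
move=> f g h /mapP[i /[!mem_iota] /= li [-> ->]] /mapP[j /[!mem_iota] /= lj [-> /ed_inj E]] nij.
have [_ li2] := lt_h i li; have [_ lj2] := lt_h j lj.
by case: nij; congr ed; apply/eqP; rewrite -(eqn_add2r n./2) E.
Qed.

End Isometric.

Lemma src_cycle (T : finType) (e : rel T) (c : seq T) :
    symmetric e -> irreflexive e -> connected e ->
    graph_cycle e c -> (forall c', graph_cycle e c' -> size c <= size c') ->
  src e + maxn 2 (size c)./2 <= #|edge_set e|.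
Proof.
move=> e_sym e_irr e_conn cc c_min; have x0 : T by case: c cc {c_min}.
have geo : {in c &, forall x y, exists p, [/\ path e x p, last x p = y & size p = dist e x y]}.
  by move=> x y _ _; apply: dist_path.
have [s [<- us sE s2]] :=
  cycle_merges e_sym e_irr e_conn e_sym (fun _ _ => id) x0 cc c_min geo.
by apply: (src_le_apart e_sym e_irr e_conn us) => // f g /sE[].
Qed.
(** * Lower bounds from bridges *)

Section LowerBound.
Variables (T : finType) (r : rel T).
Hypothesis r_sym : symmetric r.

Definition del_edge (f : {set T}) : rel T := fun x y => r x y && ([set x; y] != f).

Lemma del_edge_sym f : connect_sym (del_edge f).
Proof. by apply: sym_connect_sym => x y; rewrite /del_edge /= r_sym setUC. Qed.

Lemma acyclic_bridge a b : irreflexive r -> ~ (exists c, graph_cycle r c) -> r a b ->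
  ~~ connect (del_edge [set a; b]) a b.
Proof.
move=> r_irr acyc rab; apply/negP => /connectP[p0 /shortenP[p pp up _] lp]; apply: acyc.
have ab : a != b by apply: contraTneq rab => ->; rewrite r_irr.
have pr : path r a p by apply: sub_path pp => x y /andP[].
have pb : path r a [:: b] by rewrite /= rab.
have ub : uniq [:: a; b] by rewrite /= inE ab.
have np : p <> [:: b] by move=> E; move: pp; rewrite E /= /del_edge eqxx andbF.
by have [c cc _] := two_paths_cycle r_sym pr pb up ub (esym lp) np; exists c.
Qed.

Lemma walk_uses_bridge f w n : (forall i, i < n -> r (w i) (w i.+1)) ->
  ~~ connect (del_edge f) (w 0) (w n) -> exists2 i, i < n & edge_at w i = f.
Proof.
elim: n => [|n IH] wr; first by rewrite connect0.
have [E|nE] := eqVneq (edge_at w n) f; first by exists n.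
have step : connect (del_edge f) (w n) (w n.+1) by apply: connect1; rewrite /del_edge wr.
move=> nc; have [|i lt_i Ei] := IH (fun i lt => wr i (ltnW lt)).
  by apply: contra nc => /connect_trans; apply.
by exists i => //; apply: ltnW.
Qed.

Variable e : rel T.
Hypotheses (e_irr : irreflexive e) (e_conn : connected e) (r_sub : subrel r e).

(* Two bridges always lie on a common path, which is then a geodesic using both. *)
Lemma src_ge_acyclic : symmetric e -> ~ (exists c, graph_cycle r c) ->
    (forall x x' y y' w, r x x' -> r y y' -> geodesic e x y w ->
       forall i, i < dist e x y -> r (w i) (w i.+1)) ->
  #|edge_set r| <= src e.
Proof.
move=> e_sym acyc geo.
have r_irr : irreflexive r by move=> x; apply/negP => /r_sub; rewrite e_irr.
apply: (src_ge_card e_irr e_conn).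
  by apply/subsetP => f /edge_setP[x [y [/r_sub exy ->]]]; rewrite mem_edge_set.
(* If [a] is the end of its edge away from the second edge, then both bridges separate [a] from the
   farther end [y] of the second edge. *)
have far a b c1 c2 : r a b -> r c1 c2 -> [set a; b] != [set c1; c2] ->
    ~~ connect (del_edge [set a; b]) a c1 ->
    exists x y, forall w, geodesic e x y w ->
       exists i j, [/\ i < dist e x y, j < dist e x y,
          edge_at w i = [set a; b] & edge_at w j = [set c1; c2]].
  move=> rab rc nfg nac1.
  have ncg := acyclic_bridge r_irr acyc rc.
  have nac2 : ~~ connect (del_edge [set a; b]) a c2.
    apply: contra nac1 => /connect_trans; apply.
    by rewrite del_edge_sym; apply: connect1; rewrite /del_edge rc eq_sym.
  suff [y [ryy nf ng]] : exists y, [/\ exists y', r y y', ~~ connect (del_edge [set a; b]) a y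
      & ~~ connect (del_edge [set c1; c2]) a y].
    case: ryy => y' ryy; exists a, y => w gw; have wr := geo _ _ _ _ _ rab ryy gw.
    have [w0 wn _] := gw; rewrite -{2}w0 -wn in nf; rewrite -{1}w0 -wn in ng.
    have [i lt_i Ei] := walk_uses_bridge wr nf.
    by have [j lt_j Ej] := walk_uses_bridge wr ng; exists i, j.
  have [ac1|nc1] := boolP (connect (del_edge [set c1; c2]) a c1); last first.
    by exists c1; split=> //; exists c2.
  exists c2; split=> //; first by exists c1; rewrite r_sym.
  by apply: contra ncg => ac2; rewrite del_edge_sym // (connect_trans _ ac1) // del_edge_sym.
move=> f g /edge_setP[a [b [rab ->]]] /edge_setP[c1 [c2 [rc ->]]].
have ncf := acyclic_bridge r_irr acyc rab.
have [E|nfg] := eqVneq [set a; b] [set c1; c2].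
  exists a, b => w gw; have [w0 wn _] := gw.
  have rba : r b a by rewrite r_sym.
  rewrite -{2}w0 -{2}wn in ncf.
  have [i lt_i Ei] := walk_uses_bridge (geo _ _ _ _ _ rab rba gw) ncf.
  by exists i, i; rewrite -E.
(* Without the bridge, [c1] is cut off from [a] or from [b]; in the latter case these two are
   exchanged. *)
have [ac1|nac1] := boolP (connect (del_edge [set a; b]) a c1); last exact: far.
rewrite setUC in nfg ncf ac1 *; apply: far => //; first by rewrite r_sym.
apply: contra ncf => bc1; apply: (connect_trans ac1).
by rewrite del_edge_sym.
Qed.

End LowerBound.

(** * The class G1 *)

Lemma cycle_edges_rot (T : finType) k (c : seq T) : uniq c ->
  cycle_edges (rot k c) = cycle_edges c.
Proof.
move=> uc; apply/setP => f; apply/imsetP/imsetP => -[x xc ->]; exists x => //;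
  by rewrite ?mem_rot ?next_rot // -(mem_rot k).
Qed.

Section CycleEdges.
Variables (T : finType) (e : rel T).
Hypotheses (e_sym : symmetric e) (e_irr : irreflexive e).

Lemma graph_cycle_rot k c : graph_cycle e (rot k c) = graph_cycle e c.
Proof. by rewrite /graph_cycle size_rot rot_uniq rot_cycle. Qed.

Lemma unicyclic_with_rot k c : unicyclic_with e c -> unicyclic_with e (rot k c).
Proof.
case=> conn cc uni; have /and3P[_ uc _] := cc.
by split; rewrite ?graph_cycle_rot // => c' /uni ->; rewrite cycle_edges_rot.
Qed.

Lemma nontrivial_tree_rot k c v : uniq c ->
  nontrivial_tree e (rot k c) v = nontrivial_tree e c v.
Proof. by move=> uc; rewrite /nontrivial_tree /hanging_tree /off_cycle cycle_edges_rot. Qed.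

Lemma nontrivial_treeP c v :
  reflect (exists y, off_cycle e c v y) (nontrivial_tree e c v).
Proof.
apply: (iffP card_gt1P) => [[x [y [+ + xy]]]|[y vy]].
  rewrite !inE => /connectP[p pp Ex] /connectP[q pq Ey]; move: xy; rewrite {x}Ex {y}Ey.
  case: p pp => [_|z p /= /andP[? _] _]; last by exists z.
  case: q pq => [_ /=|z q /= /andP[? _] _]; last by exists z.
  by rewrite eqxx.
exists v, y; rewrite !inE connect0 connect1 //; split=> //.
by apply: contraTneq vy => ->; rewrite /off_cycle /= e_irr.
Qed.

Lemma cycle_edgesP c x0 f : graph_cycle e c ->
  reflect (exists2 i, i < size c & f = [set cyc c x0 i; cyc c x0 i.+1]) (f \in cycle_edges c).
Proof.
move=> cc; apply: (iffP imsetP) => [[x xc ->]|[i lt_i ->]].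
  by have [i lt_i <-] := cycP x0 xc; exists i; rewrite // (cyc_next x0 cc).
by exists (cyc c x0 i); rewrite ?(cyc_mem x0 cc) // (cyc_next x0 cc).
Qed.

Lemma cycle_edges3 a b c : graph_cycle e [:: a; b; c] ->
  cycle_edges [:: a; b; c] = [set [set a; b]; [set b; c]; [set c; a]].
Proof.
move=> cc; apply/setP => f; rewrite !inE -!orbA.
apply/(cycle_edgesP a _ cc)/or3P => [[[|[|[|]]]] //= _ ->|];
  first [by constructor 1 | by constructor 2 | by constructor 3 | idtac].
by case=> /eqP ->; [exists 0 | exists 1 | exists 2].
Qed.

Lemma cycle_edges4 a b c d : graph_cycle e [:: a; b; c; d] ->
  cycle_edges [:: a; b; c; d] = [set [set a; b]; [set b; c]; [set c; d]; [set d; a]].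
Proof.
move=> cc; apply/setP => f; rewrite !inE -!orbA.
apply/(cycle_edgesP a _ cc)/or4P => [[[|[|[|[|]]]]] //= _ ->|];
  first [by constructor 1 | by constructor 2 | by constructor 3 | by constructor 4 | idtac].
by case=> /eqP ->; [exists 0 | exists 1 | exists 2 | exists 3].
Qed.

End CycleEdges.

Section Triangle.
Variables (T : finType) (e : rel T).
Hypotheses (e_sym : symmetric e) (e_irr : irreflexive e) (e_conn : connected e).
Local Notation d := (dist e).
Local Notation E := (edge_set e).

Let dS := dist_sym e_sym e_conn.
Let d1 := dist_edge e_irr e_conn.

(** The vertex remains in the type as an isolated one, so edges and distances of both graphs can be
    compared directly. *)
Definition del_vertex (w : T) : rel T := fun x y => [&& e x y, x != w & y != w].

Lemma del_vertex_sym w : symmetric (del_vertex w).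
Proof. by move=> x y; rewrite /del_vertex e_sym [(x != w) && _]andbC. Qed.

Lemma del_vertex_sub w : subrel (del_vertex w) e.
Proof. by move=> x y /and3P[]. Qed.

Lemma graph_cycle_del_vertex w c :
  graph_cycle (del_vertex w) c = graph_cycle e c && (w \notin c).
Proof.
apply/idP/andP => [cc|[cc wc]]; have /and3P[sz uc cyc_c] := cc.
  split; first by apply/and3P; split=> //; apply: sub_cycle cyc_c; apply: del_vertex_sub.
  by apply/negP => /(next_cycle cyc_c)/and3P[_ /eqP].
apply/and3P; split=> //; apply: (sub_in_cycle (P := mem c)) cyc_c; last by apply/allP.
by move=> x y xc yc exy; rewrite /del_vertex exy /=; apply/andP; split;
  apply: contraNneq wc => <-.
Qed.

Variables u v w : T.
Hypotheses (euv : e u v) (deg_w : forall x, e w x = (x == u) || (x == v)).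

(** The only neighbors of [w] are adjacent, whereas the vertices before and after an inner vertex of
    a geodesic are at distance 2. *)
Lemma geodesic_avoid_deg2 x y g : geodesic e x y g -> x != w -> y != w ->
  forall i, i <= d x y -> g i != w.
Proof.
move=> gg xw yw i ni; have [g0 gn ge] := gg; apply/eqP => gw.
have i0 : i != 0 by apply: contraNneq xw => i0; rewrite -g0 -i0 gw.
have i1 : i != d x y by apply: contraNneq yw => i1; rewrite -gn -i1 gw.
have lt_i : i < d x y by rewrite ltn_neqAle i1.
case: i i0 gw ni i1 lt_i => // i _ gw ni i1 lt_i.
have := geodesic_dist e_irr e_conn gg (leqW (leqnSn i)) lt_i.
have := ge i (ltnW lt_i); rewrite e_sym gw deg_w; have := ge _ lt_i; rewrite gw deg_w.
have D1 := d1 euv; have D2 : d v u = 1 by rewrite dS.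
by move=> /orP[]/eqP -> /orP[]/eqP ->; rewrite ?dist_xx ?D1 ?D2; clear; lia.
Qed.

Lemma del_vertex_geodesic x y g : geodesic e x y g -> x != w -> y != w ->
  forall i, i < d x y -> del_vertex w (g i) (g i.+1).
Proof.
move=> gg xw yw i lt_i; have av := geodesic_avoid_deg2 gg xw yw.
by have [_ _ ge] := gg; rewrite /del_vertex ge // !av // ltnW.
Qed.

(** A shortest cycle among those avoiding [w] is isometric in the whole graph and yields at least
    two mergers. The two edges at [w] give another one, which does not interfere because the edges
    of that cycle avoid [w]. *)
Lemma src_triangle_deg2 : (exists c, graph_cycle (del_vertex w) c) -> src e + 3 <= #|E|.
Proof.
case/shortest_cycle => c cc c_min; have x0 : T by [].
have uv := edge_neq e_irr euv.
have [ewu ewv] : e w u /\ e w v by rewrite !deg_w !eqxx orbT.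
have wu := edge_neq e_irr ewu; have wv := edge_neq e_irr ewv.
have := cc; rewrite graph_cycle_del_vertex => /andP[_ wc].
have geo : {in c &, forall x y,
    exists p, [/\ path (del_vertex w) x p, last x p = y & size p = d x y]}.
  move=> x y xc yc; have [g gg] := geodesic_exists e_conn x y.
  have dg := del_vertex_geodesic gg (memPn wc _ xc) (memPn wc _ yc).
  have [g0 gn _] := gg.
  exists (mkseq (g \o succn) (d x y)); rewrite size_mkseq; split=> //.
    apply/(pathP x) => i; rewrite size_mkseq => lt_i.
    rewrite nth_mkseq //=; case: i lt_i => [|i] lt_i /=; first by rewrite -{1}g0 dg.
    by rewrite nth_mkseq ?dg // ltnW.
  rewrite (last_nth x) size_mkseq -[RHS]gn; case: (d x y) => [|n]; first by rewrite g0.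
  by rewrite /= nth_mkseq.
have [s [sz us sE s2]] := cycle_merges e_sym e_irr e_conn (del_vertex_sym w)
  (@del_vertex_sub w) x0 cc c_min geo.
have wE f : f \in edge_set (del_vertex w) -> f \in E /\ w \notin f.
  case/edge_setP => x [y [/and3P[exy xw yw] ->]]; rewrite mem_edge_set //.
  by rewrite !inE negb_or ![w == _]eq_sym xw.
apply: (@leq_trans (src e + size (([set w; u], [set w; v]) :: s))).
  by rewrite leq_add2l /= ltnS sz leq_maxl.
have wus : [set w; u] \notin unzip1 s.
  by apply/mapP => -[[f g] /sE[/wE[_ +] _ _ _] /= E]; rewrite -E set21.
have wvs f g : (f, g) \in s -> w \notin f /\ w \notin g.
  by case/sE => /wE[_ ?] /wE[_ ?].
have ap : apart e [set w; u] [set w; v].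
  by apply: (apart_dist e_irr e_conn); rewrite ?dist_xx ?(dS u w) ?(d1 euv) ?(d1 ewu) ?(d1 ewv).
apply: (src_le_apart e_sym e_irr e_conn).
- by rewrite /= wus.
- move=> f g; rewrite inE => /predU1P[[-> ->]|fg].
    rewrite !mem_edge_set // ewu ewv /= inE negb_or; split=> //; apply/andP; split.
      by set2_neq.
    by apply/mapP => -[[f' g'] /wvs[/= + _] E]; rewrite -E set21.
  have [/wE[? _] /wE[? wg] gs _] := sE _ _ fg; split=> //.
  by rewrite /= inE negb_or gs andbT; apply: contraNneq wg => ->; rewrite set21.
- by move=> f g; rewrite inE => /predU1P[[-> ->]|/sE[]].
move=> f g h; rewrite !inE !xpair_eqE.
case/orP=> [/andP[/eqP -> /eqP ->]|sf]; case/orP=> [/andP[/eqP -> /eqP E]|sg] //.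
- by have [_] := wvs _ _ sg; rewrite set21.
- by have [_] := wvs _ _ sf; rewrite E set21.
exact: s2 sf sg.
Qed.

End Triangle.

Section ClassG1.
Variables (T : finType) (e : rel T).
Hypotheses (e_sym : symmetric e) (e_irr : irreflexive e) (e_conn : connected e).
Local Notation E := (edge_set e).

(** Every cycle passes through [w], hence through [u w v]. If it is longer than the triangle,
    replacing this passage by the edge [u v] leaves a cycle without [w]. *)
Lemma triangle_class_G1 u v w : e u v ->
    (forall x, e w x = (x == u) || (x == v)) ->
    ~ (exists c, graph_cycle (del_vertex e w) c) ->
  class_G1 e.
Proof.
move=> euv deg_w acyc; exists [:: w; u; v].
have [ewu ewv] : e w u /\ e w v by rewrite !deg_w !eqxx orbT.
have uv := edge_neq e_irr euv.
have wu := edge_neq e_irr ewu; have wv := edge_neq e_irr ewv.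
have cc : graph_cycle e [:: w; u; v].
  apply/and3P; split=> //; last by rewrite /= ewu euv e_sym ewv.
  by rewrite /= !inE negb_or andbT; do ![apply/andP; split]; apply/eqP.
split=> //.
  split=> // c' cc'; have /and3P[_ uc' _] := cc'.
  have wc' : w \in c'.
    apply/negPn/negP => wc'; apply: acyc; exists c'.
    by rewrite graph_cycle_del_vertex cc'.
  have [k s Es] := rot_to wc'; rewrite -(cycle_edges_rot k uc') Es.
  move: cc'; rewrite -(graph_cycle_rot e k) Es {c' uc' wc' Es} => cc'.
  case: s cc' => [|a [|b t]] // cc'; have /and3P[_ us cyc_s] := cc'.
  have ewa : e w a by case/andP: cyc_s.
  have ewl : e w (last b t) by move: cyc_s; rewrite /= rcons_path [e _ w]e_sym => /and4P[].
  have al : a != last b t.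
    by case/and3P: us => _ + _; apply: contraNneq => ->; apply: mem_last.
  have [t0|t0] := eqVneq t [::].
    move: cc' ewa ewl al {us cyc_s}; rewrite {}t0 /= => cc' ewa ewl al.
    rewrite (cycle_edges3 cc) (cycle_edges3 cc').
    move: ewa ewl al; rewrite !deg_w => /orP[]/eqP -> /orP[]/eqP ->; rewrite ?eqxx // => _.
    apply/setP => f; rewrite !inE (setUC [set v] [set u]) (setUC [set w] [set v]).
    by rewrite (setUC [set u] [set w]); do 3 case: (f == _).
  case: acyc; exists [:: a, b & t]; rewrite graph_cycle_del_vertex.
  have /andP[ws us'] := us; rewrite ws andbT; apply/and3P; split=> //.
    by case: t t0 {cc' us cyc_s ewl al ws us'}.
  move: cyc_s; rewrite /= !rcons_path => /and4P[_ -> -> _] /=.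
  by move: ewa ewl al; rewrite !deg_w => /orP[]/eqP -> /orP[]/eqP ->; rewrite ?eqxx // e_sym.
apply: (@leq_trans #|[set u; v]|); last by rewrite cards2; case: eqP.
apply/subset_leq_card/subsetP => x; rewrite !inE.
case/andP => /or3P[]/eqP-> //; rewrite ?eqxx ?orbT // => /(nontrivial_treeP e_irr)[y].
case/andP; rewrite deg_w (cycle_edges3 cc) !inE => /orP[]/eqP ->; rewrite ?eqxx //.
by rewrite [[set w; v]]setUC eqxx orbT.
Qed.

(** Some vertex [w] of the triangle has a trivial tree and so degree 2. All edges but the two at [w]
    form an acyclic graph that contains every geodesic between vertices other than [w]. *)
Lemma class_G1_src : class_G1 e -> #|E| <= src e + 2.
Proof.
case=> c [uni sz le2]; have [_ cc _] := uni; have /and3P[_ uc _] := cc.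
have [w wc wt] : exists2 w, w \in c & ~~ nontrivial_tree e c w.
  apply/exists_inP; rewrite -negb_forall_in; apply/negP => /forall_inP nt.
  move: le2; rewrite leqNgt; apply/negP/negPn; rewrite -sz -(card_uniqP uc).
  by apply/subset_leq_card/subsetP => x xc; rewrite inE xc nt.
have [k s Es] := rot_to wc.
have {}uni : unicyclic_with e (w :: s) by rewrite -Es; apply: unicyclic_with_rot.
have {}wt : ~~ nontrivial_tree e (w :: s) w by rewrite -Es nontrivial_tree_rot.
have szs : size (w :: s) = 3 by rewrite -Es size_rot.
case: s szs uni wt {Es} => [|u [|v [|? ?]]] // _ uni wt {c sz le2 wc k cc uc}.
have [_ cc c_uni] := uni.
have /and3P[_ uc /and4P[ewu euv evw _]] := cc.
have deg_w x : e w x = (x == u) || (x == v).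
  apply/idP/orP => [ewx|[]/eqP-> //]; last by rewrite e_sym.
  have : ~~ off_cycle e [:: w; u; v] w x.
    by apply: contra wt => off; apply/(nontrivial_treeP e_irr); exists x.
  rewrite /off_cycle /= ewx negbK (cycle_edges3 cc) !inE !eq_set2 !eqxx /=.
  have xw : (x == w) = false by apply: contraTF ewx => /eqP ->; rewrite e_irr.
  rewrite xw !andbF !orbF.
  have wu : (w == u) = false by apply: contraTF ewu => /eqP ->; rewrite e_irr.
  have wv : (w == v) = false by apply: contraTF evw => /eqP ->; rewrite e_irr.
  by rewrite wu wv /= ?orbF => /orP[]->; auto.
have sub_E : E \subset edge_set (del_vertex e w) :|: [set [set w; u]; [set w; v]].
  apply/subsetP => f /edge_setP[x [y [exy ->]]].
  rewrite in_setU (mem_edge_set (del_vertex_sym e_sym w)) !inE /del_vertex exy /=.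
  have [xw|xw] := eqVneq x w.
    by move: exy; rewrite xw deg_w => /orP[]/eqP ->; rewrite eqxx ?orbT.
  have [yw|yw] //= := eqVneq y w.
  by move: exy; rewrite yw e_sym deg_w => /orP[]/eqP ->; rewrite setUC eqxx ?orbT.
apply: leq_trans (subset_leq_card sub_E) _.
apply: leq_trans (leq_card_setU _ _) _; apply: leq_add; last by rewrite cards2; case: eqP.
apply: (src_ge_acyclic (del_vertex_sym e_sym w) e_irr e_conn (@del_vertex_sub _ e w) e_sym).
  case=> c'; rewrite graph_cycle_del_vertex => /andP[cc' wc'].
  have : [set w; u] \in cycle_edges c' by rewrite (c_uni _ cc') (cycle_edges3 cc) !inE eqxx.
  case/imsetP => x xc' Ef; have : w \in [set x; next c' x] by rewrite -Ef set21.
  rewrite !inE => /orP[]/eqP wx; move: wc'; rewrite wx ?mem_next xc' //.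
move=> x x' y y' g /and3P[_ xw _] /and3P[_ yw _] gg.
exact: del_vertex_geodesic euv deg_w _ _ _ gg xw yw.
Qed.

End ClassG1.

(** * Trees hanging at a vertex *)

Lemma walk_crossing (T : Type) (Q : pred T) (w : nat -> T) n : Q (w 0) -> ~~ Q (w n) ->
  exists i, [/\ i < n, Q (w i) & ~~ Q (w i.+1)].
Proof.
elim: n => [-> //|n IH] Q0 Qn; have [Qwn|nQ] := boolP (Q (w n)); first by exists n.
by have [i [lt_i Qi Qi1]] := IH Q0 nQ; exists i; split=> //; apply: ltnW.
Qed.

Lemma cycle_two_neighbors (T : finType) (e : rel T) c x : symmetric e ->
  graph_cycle e c -> x \in c -> exists a b, [/\ a \in c, b \in c, a <> b, e x a & e x b].
Proof.
move=> e_sym cc xc; have [k s Es] := rot_to xc.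
have memE y : (y \in c) = (y \in x :: s) by rewrite -Es mem_rot.
move: cc; rewrite -(graph_cycle_rot e k) Es; case: s memE {Es} => [|a [|b t]] // memE.
case/and3P => _ /and3P[_ + _]; rewrite /= rcons_path => abt /and4P[xa _ _ lx].
exists a, (last b t); rewrite !memE; split=> //.
- by rewrite !inE eqxx orbT.
- by rewrite 2!in_cons mem_last !orbT.
- by move=> al; rewrite al mem_last in abt.
by rewrite e_sym.
Qed.

(* [off] plays the role of [off_cycle e c]; the component of [v] for [off] is joined
   to the rest of the graph through [v] only. *)
Section Hanging.
Variables (T : finType) (e off : rel T) (v : T).
Hypotheses (e_sym : symmetric e) (e_irr : irreflexive e) (e_conn : connected e).
Hypotheses (off_sym : symmetric off) (off_sub : subrel off e).
Local Notation d := (dist e).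
Local Notation H := (connect off v).
Hypothesis cut : forall a b, H a -> ~~ H b -> e a b -> a = v.
Hypothesis inner : forall a b, H a -> H b -> e a b -> off a b.

Let dS := dist_sym e_sym e_conn.

Lemma off_irr x : off x x = false.
Proof. by apply/negP => /off_sub; rewrite e_irr. Qed.

Lemma dist_cut y z : H y -> ~~ H z -> d y z = d y v + d v z.
Proof.
move=> Hy Hz; have [w gw] := geodesic_exists e_conn y z; have [w0 wn we] := gw.
have [||i [lt_i Hi Hi1]] := @walk_crossing _ H w (d y z); rewrite ?w0 ?wn //.
have wi := cut Hi Hi1 (we _ lt_i).
have := geodesic_dist e_irr e_conn gw (leq0n i) (ltnW lt_i).
have := geodesic_dist e_irr e_conn gw (ltnW lt_i) (leqnn _).
by rewrite wi w0 wn => -> ->; move: lt_i; clear; lia.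
Qed.

Local Notation q p := (nth v (v :: p)).

(** A pendant path under construction: only its last vertex may still have further neighbors. *)
Definition initial_ray p := [/\ uniq (v :: p), path off v p &
  forall i y, i < size p -> off (q p i) y -> y = q p i.+1 \/ 0 < i /\ y = q p i.-1].

(** A path that exhausts the tree at [v]; this is the working form of [hanging_path]. *)
Definition full_ray p := initial_ray p /\
  forall y, off (last v p) y -> 0 < size p /\ y = q p (size p).-1.

Lemma initial_ray_connect p i : initial_ray p -> i <= size p -> H (q p i).
Proof.
case=> _ /(pathP v) pp _; elim: i => [|i IH] lt_i; first exact: connect0.
by apply: connect_trans (IH (ltnW lt_i)) _; apply/connect1/pp.
Qed.

Lemma full_ray_neighbor p i y : full_ray p -> i <= size p -> off (q p i) y ->
  i < size p /\ y = q p i.+1 \/ 0 < i /\ y = q p i.-1.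
Proof.
case=> -[_ _ sat] sat_last; rewrite leq_eqVlt => /predU1P[->|lt_i /sat[]]; auto.
by rewrite -last_nth => /sat_last; auto.
Qed.

(** The index, set to 0 outside the tree, drops by at most one along an edge. Vertices of the tree
    off the path have the default index [(size p).+1], which is right because only the last vertex
    of the path has neighbors among them. *)
Lemma index_le_dist p z : initial_ray p -> H z -> index z (v :: p) <= d z v.
Proof.
move=> ray Hz; have [up pp sat] := ray.
pose f z := if H z then index z (v :: p) else 0.
have idxP x : x \in v :: p -> exists2 i, i <= size p & x = q p i /\ index x (v :: p) = i.
  move=> xp; exists (index x (v :: p)).
    by rewrite -ltnS -[(size p).+1]/(size (v :: p)) index_mem.
  by rewrite nth_index.
have idxn x : x \notin v :: p -> index x (v :: p) = (size p).+1.
  by move=> xp; apply/eqP; rewrite -[_.+1]/(size (v :: p)) eqn_leq index_size leqNgt index_mem.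
have idxq i : i <= size p -> index (q p i) (v :: p) = i by move=> le_i; rewrite index_uniq.
have lip a b : e a b -> f a <= (f b).+1.
  rewrite /f => eab; case: ifP => // Ha; case: ifPn => [Hb|nHb]; last first.
    by rewrite (cut Ha nHb eab) /= eqxx.
  have oab := inner Ha Hb eab; have oba : off b a by rewrite off_sym.
  have [/idxP[i le_i [aE ->]]|an] := boolP (a \in v :: p).
    have [/idxP[j le_j [bE ->]]|bn] := boolP (b \in v :: p); last first.
      by rewrite idxn //; move: le_i; clear; lia.
    have [lt_i|ge_i] := ltnP i (size p).
      rewrite aE in oab; have [E|[i0 E]] := sat _ _ lt_i oab.
        have := idxq i.+1 lt_i; rewrite -E bE idxq // => ->; clear; lia.
      have := idxq i.-1 (leq_trans (leq_pred _) le_i); rewrite -E bE idxq // => ->; clear; lia.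
    have [lt_j|ge_j] := ltnP j (size p); last by move: le_i ge_j; clear; lia.
    rewrite bE in oba; have [E|[j0 E]] := sat _ _ lt_j oba.
      have := idxq j.+1 lt_j; rewrite -E aE idxq // => ->; clear; lia.
    have := idxq j.-1 (leq_trans (leq_pred _) le_j); rewrite -E aE idxq // => ->; clear; lia.
  rewrite idxn // ltnS.
  have [/idxP[j le_j [bE ->]]|bn] := boolP (b \in v :: p); last by rewrite idxn.
  rewrite leqNgt; apply/negP => lt_j; rewrite bE in oba; case/negP: an.
  have [->|[j0 ->]] := sat _ _ lt_j oba; rewrite mem_nth //= ltnS.
  by apply: leq_trans (leq_pred _) le_j.
have := dist_lipschitz e_conn z v lip; rewrite /f Hz connect0 /= eqxx add0n; exact.
Qed.

(** The path is grown as long as possible. Two new neighbors of its last vertex [t] are a branching,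
    a single one extends the path, and if there is none the path is full. New neighbors are not
    closer to [v] than [t], by [index_le_dist]. In the application [P] says that three colors are
    saved. *)
Lemma initial_ray_extend (P : Prop) p : initial_ray p ->
    (forall t x1 x2, H t -> off t x1 -> off t x2 -> x1 <> x2 ->
       d t v <= d x1 v -> d t v <= d x2 v -> P) ->
  P \/ exists p, full_ray p.
Proof.
have [n] := ubnP (#|T| - size p); elim: n p => // n IH p lt_n ray branch.
have [up pp sat] := ray; set t := last v p.
have tE : t = q p (size p) by rewrite /t (last_nth v).
have Ht : H t by rewrite tE; apply: initial_ray_connect.
pose new y := off t y && ~~ ((0 < size p) && (y == q p (size p).-1)).
have newN y : new y -> y \notin v :: p.
  case/andP => oty ny; apply: contra ny => /(nthP v)[i]; rewrite /= ltnS => le_i yE.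
  have lt_i : i < size p.
    by rewrite ltn_neqAle le_i andbT; apply: contraTneq oty => Ei; rewrite -yE Ei -tE off_irr.
  have : off (q p i) t by rewrite yE off_sym.
  have inj a b : a <= size p -> b <= size p -> q p a = q p b -> a = b.
    by move=> la lb /eqP; rewrite nth_uniq // => /eqP.
  rewrite tE => /(sat _ _ lt_i)[/inj|[i0 /inj]] E; last first.
    by move: (E (leqnn _) (leq_trans (leq_pred _) le_i)) lt_i i0; clear; lia.
  by rewrite (E (leqnn _) lt_i) /= -yE eqxx.
have new_dist y : new y -> d t v <= d y v.
  move=> ny; have Hy : H y by case/andP: ny => /connect1/(connect_trans Ht).
  have := index_le_dist ray Hy; have -> : index y (v :: p) = (size p).+1.
    by apply/eqP; rewrite -[_.+1]/(size (v :: p)) eqn_leq index_size leqNgt index_mem newN.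
  by have := dist_le_path (sub_path off_sub pp); rewrite -/t dS; clear; lia.
have [y1 ny1|no_new] := pickP new; last first.
  right; exists p; split=> // y oty; have := no_new y.
  rewrite /new oty /= => /negbFE/andP[-> /eqP].
  by [].
have [y2 /andP[ny2 y12]|uniq_new] := pickP [pred y | new y & y != y1].
  left; case/andP: (ny1) => o1 _; case/andP: (ny2) => o2 _.
  by apply: (branch t y1 y2) => //; [apply/nesym/eqP | exact: new_dist | exact: new_dist].
have [o1 _] := andP ny1.
have up' : uniq (v :: rcons p y1) by rewrite -rcons_cons rcons_uniq newN.
apply: (IH (rcons p y1)) => //.
  have := max_card (mem (v :: rcons p y1)); rewrite (card_uniqP up') /= !size_rcons.
  move=> lt_T; apply: leq_trans (ltn_sub2l _ _) lt_n; [exact: ltnW | exact: ltnSn].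
split=> //; first by rewrite rcons_path pp.
have qE i : i <= size p -> q (rcons p y1) i = q p i.
  by move=> le_i; rewrite -rcons_cons nth_rcons /= ltnS le_i.
move=> i y; rewrite size_rcons ltnS leq_eqVlt => /predU1P[->|lt_i].
  rewrite qE // -tE => oty; have [ny|nny] := boolP (new y).
    left; have := uniq_new y; rewrite /= ny /= => /negbFE/eqP ->.
    by rewrite nth_rcons ltnn eqxx.
  move: nny; rewrite /new oty /= => /negbNE/andP[p0 /eqP yE]; right.
  by rewrite qE ?leq_pred.
rewrite !qE //; last exact: ltnW; last exact: leq_trans (leq_pred _) (ltnW lt_i).
exact: sat.
Qed.

Lemma full_ray_mem p x : full_ray p -> H x = (x \in v :: p).
Proof.
move=> ray; have [ini _] := ray; apply/idP/idP => [|/(nthP v)[i lt_i <-]]; last first.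
  exact: initial_ray_connect.
case/connectP => s; elim/last_ind: s x => [|s z IH] x; first by move=> _ ->; apply: mem_head.
rewrite rcons_path last_rcons => /andP[/IH/(_ erefl)/(nthP v)[i lt_i <-] oz] ->.
have [[lt ->]|[i0 ->]] := full_ray_neighbor ray lt_i oz; apply: mem_nth => //.
by apply: leq_ltn_trans (leq_pred _) lt_i.
Qed.

Lemma full_ray_off p x y : full_ray p -> H x -> off x y = ([set x; y] \in walk_edges v p).
Proof.
move=> ray; rewrite (full_ray_mem _ ray) walk_edgesE => /(nthP v)[i lt_i <-].
have [[up /(pathP v) pp _] _] := ray.
apply/idP/mapP => [oy|[j]].
  have [[lt ->]|[i0 ->]] := full_ray_neighbor ray lt_i oy.
    by exists i; rewrite // mem_iota.
  exists i.-1; last by rewrite /edge_at prednK // setUC.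
  by rewrite mem_iota /= add0n prednK.
rewrite mem_iota /= add0n => lt_j /set2_inj[[-> ->]|[-> ->]]; first exact: pp.
by rewrite off_sym; apply: pp.
Qed.

Lemma hanging_full_ray p : uniq (v :: p) -> (forall x, H x = (x \in v :: p)) ->
    (forall x y, H x -> H y -> off x y = ([set x; y] \in walk_edges v p)) ->
  full_ray p.
Proof.
move=> up memH offH; have inj i j : i <= size p -> j <= size p -> q p i = q p j -> i = j.
  by move=> li lj /eqP; rewrite nth_uniq // => /eqP.
have Hq i : i <= size p -> H (q p i) by move=> le_i; rewrite memH mem_nth.
have step i : i < size p -> off (q p i) (q p i.+1).
  move=> lt_i; rewrite offH ?Hq // 1?ltnW // walk_edgesE.
  by apply/mapP; exists i; rewrite ?mem_iota.
have nbr i y : i <= size p -> off (q p i) y ->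
    i < size p /\ y = q p i.+1 \/ 0 < i /\ y = q p i.-1.
  move=> le_i oy; have Hy : H y := connect_trans (Hq i le_i) (connect1 oy).
  move: oy; rewrite offH ?Hq // walk_edgesE => /mapP[j].
  rewrite mem_iota /= add0n => lt_j /set2_inj[[/(inj _ _ le_i (ltnW lt_j)) -> ->]|]; first by left.
  by case=> /(inj _ _ le_i lt_j) -> ->; right.
split; first split=> //.
- by apply/(pathP v) => i lt_i; apply: step.
- by move=> i y lt_i /(nbr _ _ (ltnW lt_i))[[_ ->]|]; auto.
by move=> y; rewrite (last_nth v) => /(nbr _ _ (leqnn _))[[]|]; rewrite ?ltnn.
Qed.

Lemma full_ray_dist p : full_ray p -> size p <= d (last v p) v.
Proof.
move=> ray; have [ini _] := ray; have [up _ _] := ini.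
have /(index_le_dist ini) : H (last v p) by rewrite (full_ray_mem _ ray) mem_last.
by rewrite (last_nth v) index_uniq.
Qed.

(** The vertex of the cycle farthest along the path, if it is not [v], has two neighbors on the
    cycle, but only its predecessor on the path qualifies. *)
Lemma full_ray_cycle p c x : full_ray p -> graph_cycle e c -> x \in c -> H x -> x = v.
Proof.
move=> ray cc xc Hx; apply/eqP; have [ini _] := ray; have [up _ _] := ini.
pose P := [pred z | (z \in c) && H z]; have Px : P x by rewrite /= xc Hx.
case: (arg_maxnP (index^~ (v :: p)) Px) => z /andP[zc Hz] zmax.
have /(nthP v)[i le_i qi] : z \in v :: p by rewrite -(full_ray_mem _ ray).
have idx j : j <= size p -> index (q p j) (v :: p) = j by move=> le_j; rewrite index_uniq.
case: i le_i qi => [|i] le_i qi.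
  have := zmax x Px; rewrite -qi /= eqxx; case: eqP => // ->; by rewrite eqxx.
have {}le_i : i.+1 <= size p by [].
have nbr a : a \in c -> e z a -> a = q p i.
  move=> ac eza; have Ha : H a.
    apply/negPn/negP => nHa; have zv := cut Hz nHa eza.
    by have := idx i.+1 le_i; rewrite qi zv /= eqxx.
  have oza := inner Hz Ha eza; rewrite -qi in oza.
  have [[lt aE]|[_ ->]//] := full_ray_neighbor ray le_i oza.
  have Pa : P a by rewrite /= ac Ha.
  have : index a (v :: p) <= index z (v :: p) := zmax a Pa.
  by rewrite aE -qi !idx // ltnn.
have [a [b [ac bc ab za zb]]] := cycle_two_neighbors e_sym cc zc.
by case: ab; rewrite (nbr a ac za) (nbr b bc zb).
Qed.

End Hanging.

(** * The classes G2 and G3 *)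

Lemma card_cycle_edges (T : finType) (e : rel T) c : graph_cycle e c ->
  #|cycle_edges c| = size c.
Proof.
move=> cc; have x0 : T by case: c cc.
pose ed (i : 'I_(size c)) := [set cyc c x0 i; cyc c x0 i.+1].
have -> : cycle_edges c = ed @: setT.
  apply/setP => f; apply/(cycle_edgesP x0 f cc)/imsetP => [[i lt_i ->]|[i _ ->]].
    by exists (Ordinal lt_i).
  by exists i.
rewrite card_imset ?cardsT ?card_ord // => i j /(cyc_edge_inj cc).
by move=> /(_ (ltn_ord i) (ltn_ord j)) /val_inj.
Qed.

Lemma cycle_edges_sub_edge_set (T : finType) (e : rel T) c : graph_cycle e c ->
  cycle_edges c \subset edge_set e.
Proof.
case/and3P=> _ _ cyc_c; apply/subsetP => f /imsetP[x xc ->].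
by apply/imset2P; exists x (next c x); rewrite ?inE //= next_cycle.
Qed.

Lemma connect_isolated (T : finType) (r : rel T) x y :
  (forall z, ~~ r x z) -> connect r x y -> y = x.
Proof.
by move=> iso /connectP[[|z p] /= pp ->] //; case/andP: pp; rewrite (negbTE (iso z)).
Qed.

Lemma full_ray_hanging_path (T : finType) (e : rel T) c v p :
  symmetric e -> full_ray (off_cycle e c) v p -> hanging_path e c v.
Proof.
move=> e_sym ray; have off_sym : symmetric (off_cycle e c).
  by move=> x y; rewrite /off_cycle /= e_sym setUC.
exists p; have [[up _ _] _] := ray; split=> // [x|x y].
  by rewrite inE (full_ray_mem _ ray).
by rewrite !inE => Hx _; apply: full_ray_off.
Qed.

Lemma hanging_path_full_ray (T : finType) (e : rel T) c v :
  hanging_path e c v -> exists p, full_ray (off_cycle e c) v p.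
Proof.
case=> p [up memH offH]; exists p; apply: hanging_full_ray => // [x|x y Hx Hy].
  by rewrite -memH inE.
by apply: offH; rewrite inE.
Qed.

Section SquareTrees.
Variables (T : finType) (e : rel T).
Hypotheses (e_sym : symmetric e) (e_irr : irreflexive e) (e_conn : connected e).
Local Notation d := (dist e).
Local Notation E := (edge_set e).

Let dS := dist_sym e_sym e_conn.

Variables v0 v1 v2 v3 : T.
Local Notation c := [:: v0; v1; v2; v3].
Local Notation off := (off_cycle e c).
Hypotheses (cc : graph_cycle e c) (sq : square e v0 v1 v2 v3).

Lemma off_cycle_sym : symmetric off.
Proof. by move=> x y; rewrite /off_cycle /= e_sym setUC. Qed.

Lemma off_cycle_sub : subrel off e.
Proof. by move=> x y /andP[]. Qed.

(** The diagonals of the square are at distance 2, so it has no chords. *)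
Lemma off_squareE x y : off x y = e x y && ~~ ((x \in c) && (y \in c)).
Proof.
rewrite /off_cycle /=; case exy: (e x y) => //=; congr (~~ _).
have nv : e v0 v2 = false /\ e v1 v3 = false.
  have [_ _ _ _ [D02 D13]] := sq.
  by split; apply/negP => /(dist_edge e_irr e_conn); rewrite ?D02 ?D13.
have nv' : e v2 v0 = false /\ e v3 v1 = false by rewrite ![e _ v0]e_sym ![e _ v1]e_sym.
rewrite (cycle_edges4 cc) !in_setU !in_set1; apply/idP/idP.
  by rewrite -!orbA => /or4P[]; rewrite eq_set2 => /orP[] /andP[/eqP-> /eqP->];
    rewrite !inE !eqxx ?orbT.
rewrite !inE => /andP[/or4P[] /eqP xE /or4P[] /eqP yE]; move: exy; rewrite {}xE {}yE;
  rewrite ?e_irr ?(proj1 nv) ?(proj2 nv) ?(proj1 nv') ?(proj2 nv') // => _;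
  by rewrite !eq_set2 !eqxx ?orbT.
Qed.

Hypotheses (triv1 : forall y, ~~ off v1 y) (triv3 : forall y, ~~ off v3 y).
Hypothesis nconn : ~~ connect off v0 v2.

Lemma square_cover z : [|| connect off v0 z, connect off v2 z | z \in [:: v1; v3]].
Proof.
have /connectP[p pp ->] := e_conn v0 z.
elim/last_ind: p pp => [|p y IH]; first by rewrite connect0.
rewrite rcons_path last_rcons => /andP[/IH IHp epy].
have [oy|] := boolP (off (last v0 p) y).
  case/or3P: IHp => [/connect_trans|/connect_trans|].
  - by move/(_ _ (connect1 oy)) ->.
  - by move/(_ _ (connect1 oy)) ->; rewrite orbT.
  by rewrite !inE => /orP[]/eqP pE; move: oy; rewrite pE ?(negbTE (triv1 _)) ?(negbTE (triv3 _)).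
rewrite off_squareE epy negbK => /andP[_]; rewrite !inE.
by case/or4P => /eqP ->; rewrite ?connect0 ?eqxx ?orbT.
Qed.

Lemma hang_cycle (v x : T) : v \in [:: v0; v2] -> connect off v x -> x \in c -> x = v.
Proof.
have iso (u w : T) : (forall y, ~~ off u y) -> connect off w u -> w = u.
  by move=> tu; rewrite (sym_connect_sym off_cycle_sym) => /(connect_isolated tu).
rewrite !inE => /orP[]/eqP-> Hx /or4P[]/eqP xE; rewrite xE // in Hx *;
  do ?[by rewrite (iso _ _ triv1 Hx) | by rewrite (iso _ _ triv3 Hx)].
- by case/negP: nconn.
- by case/negP: nconn; rewrite (sym_connect_sym off_cycle_sym).
Qed.

Lemma hang_cut v a b : v \in [:: v0; v2] ->
  connect off v a -> ~~ connect off v b -> e a b -> a = v.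
Proof.
move=> vc Ha Hb eab; apply: (hang_cycle vc Ha).
have : ~~ off a b by apply: contra Hb => oab; apply: connect_trans Ha (connect1 oab).
by rewrite off_squareE eab negbK => /andP[].
Qed.

Lemma hang_inner v a b : v \in [:: v0; v2] ->
  connect off v a -> connect off v b -> e a b -> off a b.
Proof.
move=> vc Ha Hb eab; rewrite off_squareE eab /=; apply/negP => /andP[ac bc].
by rewrite (hang_cycle vc Ha ac) (hang_cycle vc Hb bc) e_irr in eab.
Qed.

Lemma trivial_v1_v3 w : w \in [:: v1; v3] -> ~~ nontrivial_tree e c w.
Proof.
by rewrite !inE => /orP[]/eqP ->; apply/(nontrivial_treeP e_irr) => -[y]; apply/negP.
Qed.

(** The tree at [v0] is left through [v0] only, so distances from it to the square are those to [v0]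
    plus a constant, and a fork in the tree satisfies [branching]. *)
Lemma hang0_extend : src e + 3 <= #|E| \/ exists p, full_ray off v0 p.
Proof.
have v0c : v0 \in [:: v0; v2] by rewrite inE eqxx.
have cut := fun a b => @hang_cut v0 a b v0c; have inn := fun a b => @hang_inner v0 a b v0c.
apply: (initial_ray_extend e_sym e_irr e_conn off_cycle_sym off_cycle_sub cut inn (p := [::])).
  by split.
move=> t x1 x2 Ht o1 o2 x12 lt1 lt2.
have [D01 D12 D23 D30 [D02 D13]] := square_dist e_irr e_conn sq.
have [n01 n12 n23 n30 [n02 n13]] := square_neq e_irr sq.
have out w : w \in c -> w <> v0 -> ~~ connect off v0 w.
  by move=> wc w0; apply/negP => Hw; case: w0; apply: hang_cycle v0c Hw wc.
have dout w y : w \in c -> w <> v0 -> connect off v0 y -> d y w = d y v0 + d v0 w.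
  by move=> wc w0 Hy; apply: (dist_cut e_irr e_conn cut Hy (out w wc w0)).
have c1 : v1 \in c by rewrite !inE eqxx orbT.
have c2 : v2 \in c by rewrite !inE eqxx !orbT.
have c3 : v3 \in c by rewrite !inE eqxx !orbT.
have D03 : d v0 v3 = 1 by rewrite dS.
have H1 : connect off v0 x1 by apply: connect_trans Ht (connect1 o1).
have H2 : connect off v0 x2 by apply: connect_trans Ht (connect1 o2).
apply: (src_square_branching e_sym e_irr e_conn sq (t := t) (x1 := x1) (x2 := x2)).
- split; first by split=> //; rewrite e_sym off_cycle_sub.
    by rewrite (dout v1 x1) ?(dout v1 x2) // ?D01 ?addn1 ?ltnS //; apply: nesym.
  by rewrite (dout v3 x1) ?(dout v3 x2) // ?D03 ?addn1 ?ltnS.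
- by rewrite dout // ?D01 ?addn1 //; apply: nesym.
- by rewrite dout // D03 addn1.
by rewrite dout // ?D02 ?addn2 //; apply: nesym.
Qed.

Variables p0 p2 : seq T.
Hypotheses (ray0 : full_ray off v0 p0) (ray2 : full_ray off v2 p2).

Let v0c : v0 \in [:: v0; v2]. Proof. by rewrite inE eqxx. Qed.
Let v2c : v2 \in [:: v0; v2]. Proof. by rewrite !inE eqxx orbT. Qed.

Lemma square_rays_src : #|E| <= src e + 2.
Proof.
(* The tips of the two paths are at distance at least [size p0 + 2 + size p2], while there are at
   most [4 + size p0 + size p2] edges. *)
pose x0 := last v0 p0; pose x2 := last v2 p2.
have H0 : connect off v0 x0 by rewrite (full_ray_mem _ ray0) mem_last.
have H2 : connect off v2 x2 by rewrite (full_ray_mem _ ray2) mem_last.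
have nH0 : ~~ connect off v0 x2.
  apply: contra nconn => H; apply: connect_trans H _.
  by rewrite (sym_connect_sym off_cycle_sym).
have nH2 : ~~ connect off v2 v0 by rewrite (sym_connect_sym off_cycle_sym).
have cut0 := fun a b => @hang_cut v0 a b v0c; have cut2 := fun a b => @hang_cut v2 a b v2c.
have in0 := fun a b => @hang_inner v0 a b v0c; have in2 := fun a b => @hang_inner v2 a b v2c.
have Dx := dist_cut e_irr e_conn cut0 H0 nH0.
have Dx2 := dist_cut e_irr e_conn cut2 H2 nH2.
have L0 := full_ray_dist e_conn off_cycle_sym cut0 in0 ray0.
have L2 := full_ray_dist e_conn off_cycle_sym cut2 in2 ray2.
have D02 : d v2 v0 = 2 by rewrite dS; case: sq => _ _ _ _ [].
have sub_E :
    E \subset cycle_edges c :|: [set f in walk_edges v0 p0] :|: [set f in walk_edges v2 p2].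
  apply/subsetP => f /edge_setP[x [y [exy ->]]].
  rewrite !in_setU; have [//|nc] := boolP ([set x; y] \in cycle_edges c).
  have oxy : off x y by rewrite /off_cycle /= exy.
  rewrite 2![_ \in finset _]inE; case/or3P: (square_cover x) => Hx.
  - by rewrite -(full_ray_off off_cycle_sym _ ray0 Hx) oxy.
  - by rewrite -(full_ray_off off_cycle_sym _ ray2 Hx) oxy orbT.
  by move: Hx oxy; rewrite !inE => /orP[]/eqP->; rewrite ?(negbTE (triv1 _)) ?(negbTE (triv3 _)).
have cw (x : T) p : #|[set f in walk_edges x p]| <= size p.
  by rewrite cardsE (leq_trans (card_size _)) // size_pairmap.
have E_le : #|E| <= 4 + size p0 + size p2.
  apply: leq_trans (subset_leq_card sub_E) _; apply: leq_trans (leq_card_setU _ _) _.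
  rewrite leq_add ?cw //; apply: leq_trans (leq_card_setU _ _) _.
  by rewrite (card_cycle_edges cc) leq_add2l cw.
apply: leq_trans E_le _; have := dist_le_src e_sym e_irr e_conn x0 x2.
rewrite -/x0 -/x2 in L0 L2; rewrite dS in Dx2; move: L0 L2; rewrite Dx Dx2 D02.
by clear; lia.
Qed.

Hypothesis c_min : forall c', graph_cycle e c' -> 4 <= size c'.

(** A cycle meets each pendant path in its origin at most, so all its vertices are on the square.
    The square has no chords, and counting edges gives equality. *)
Lemma square_rays_unicyclic : unicyclic_with e c.
Proof.
split=> // c' cc'; have cut0 := fun a b => @hang_cut v0 a b v0c.
have cut2 := fun a b => @hang_cut v2 a b v2c.
have in0 := fun a b => @hang_inner v0 a b v0c; have in2 := fun a b => @hang_inner v2 a b v2c.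
have sub_c x : x \in c' -> x \in c.
  move=> xc'; case/or3P: (square_cover x) => [H|H|].
  - by rewrite (full_ray_cycle e_sym cut0 in0 ray0 cc' xc' H) inE eqxx.
  - by rewrite (full_ray_cycle e_sym cut2 in2 ray2 cc' xc' H) !inE eqxx !orbT.
  by rewrite !inE => /orP[]/eqP->; rewrite eqxx !orbT.
apply/eqP; rewrite eqEcard !(card_cycle_edges (e := e)) // c_min // andbT.
apply/subsetP => f /imsetP[x xc' ->]; have /and3P[_ _ cyc_c'] := cc'.
have := off_squareE x (next c' x); rewrite !sub_c ?mem_next //= andbF /off_cycle /=.
by rewrite (next_cycle cyc_c' xc') /= => /negbFE.
Qed.

Lemma square_rays_class : class_G2 e \/ class_G3 e.
Proof.
have uni := square_rays_unicyclic.
have h0 : hanging_path e c v0 by apply: full_ray_hanging_path ray0.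
have h2 : hanging_path e c v2 by apply: full_ray_hanging_path ray2.
have [n01 n12 n23 n30 [n02 n13]] := square_neq e_irr sq.
have triv w : w \in c -> w != v0 -> w != v2 -> ~~ nontrivial_tree e c w.
  move=> wc w0 w2; apply: trivial_v1_v3.
  by move: wc; rewrite !inE (negbTE w0) (negbTE w2).
have G3 u : (forall w, w \in c -> w != u -> ~~ nontrivial_tree e c w) ->
    hanging_path e c u -> class_G3 e.
  move=> triv_u hu; exists c; split=> //.
    apply: (@leq_trans #|[set u]|); last by rewrite cards1.
    apply/subset_leq_card/subsetP => x; rewrite !(in_set, in_set1) => /andP[xc tx].
    by apply: contraTT tx => xu; apply: triv_u.
  move=> w wc tw; suff -> : w = u by [].
  by apply/eqP; apply: contraTT tw => wu; apply: triv_u.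
have [t0|t0] := boolP (nontrivial_tree e c v0); last first.
  by right; apply: G3 h2 => w wc w2; have [->//|w0] := eqVneq w v0; apply: triv.
have [t2|t2] := boolP (nontrivial_tree e c v2); last first.
  by right; apply: G3 h0 => w wc w0; have [->//|w2] := eqVneq w v2; apply: triv.
left; exists c; split=> //; exists v0, v2; split=> //.
split; rewrite ?inE ?eqxx ?orbT //; first exact/eqP.
apply/negP => /(subsetP (cycle_edges_sub_edge_set cc)); rewrite mem_edge_set //.
by move/(dist_edge e_irr e_conn); case: sq => _ _ _ _ [-> _].
Qed.

End SquareTrees.

(** * Case analysis on the girth *)

Section Cases.
Variables (T : finType) (e : rel T).
Hypotheses (e_sym : symmetric e) (e_irr : irreflexive e) (e_conn : connected e).
Local Notation d := (dist e).
Local Notation E := (edge_set e).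

Let dS := dist_sym e_sym e_conn.

Lemma triangle_case u v w : e u v -> e v w -> e w u ->
  src e + 3 <= #|E| \/ class_G1 e.
Proof.
move=> euv evw ewu.
have deg2 a b x : e a b -> e b x -> e x a -> ~~ [exists y, [&& e y x, y != a & y != b]] ->
    src e + 3 <= #|E| \/ class_G1 e.
  move=> eab ebx exa /existsPn none.
  have deg y : e x y = (y == a) || (y == b).
    apply/idP/orP => [exy|[]/eqP -> //]; last by rewrite e_sym.
    have := none y; rewrite e_sym exy /= negb_and !negbK => /orP.
    by [].
  have [cyc|acyc] := classic (exists c, graph_cycle (del_vertex e x) c).
    by left; apply: src_triangle_deg2 eab deg cyc.
  by right; apply: triangle_class_G1 eab deg acyc.
have [/existsP[x /and3P[exu /eqP xv /eqP xw]]|] :=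
  boolP [exists y, [&& e y u, y != v & y != w]]; last exact: deg2.
have [/existsP[y /and3P[eyv /eqP yw /eqP yu]]|] :=
  boolP [exists y, [&& e y v, y != w & y != u]]; last exact: deg2.
have [/existsP[z /and3P[ezw /eqP zu /eqP zv]]|] :=
  boolP [exists y, [&& e y w, y != u & y != v]]; last exact: deg2.
by left; apply: (src_triangle_pendants e_sym e_irr e_conn euv evw ewu exu eyv ezw).
Qed.

Lemma off_square_out v0 v1 v2 v3 y z : graph_cycle e [:: v0; v1; v2; v3] -> square e v0 v1 v2 v3 ->
  y \in [:: v0; v1; v2; v3] -> off_cycle e [:: v0; v1; v2; v3] y z ->
  e y z && (z \notin [:: v0; v1; v2; v3]).
Proof.
move=> cc sq yc; rewrite off_squareE // yc /=.
by case/andP => -> ->.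
Qed.

(** Here [v1] and [v3] have degree 2. Either [v0] and [v2] are joined off the square, or each has a
    tree of its own that branches or is a pendant path. *)
Lemma square_trivial_case v0 v1 v2 v3 (c := [:: v0; v1; v2; v3]) :
    graph_cycle e c -> square e v0 v1 v2 v3 ->
    (forall c', graph_cycle e c' -> 4 <= size c') ->
    ~~ nontrivial_tree e c v1 -> ~~ nontrivial_tree e c v3 ->
  src e + 3 <= #|E| \/ class_G2 e \/ class_G3 e.
Proof.
move=> cc sq c_min t1 t3.
have triv u y : ~~ nontrivial_tree e c u -> ~~ off_cycle e c u y.
  by apply: contra => o; apply/(nontrivial_treeP e_irr); exists y.
have triv1 y := triv v1 y t1; have triv3 y := triv v3 y t3.
have [conn|nconn] := boolP (connect (off_cycle e c) v0 v2).
  left; have [/andP[_ e10] /andP[e12 _] /andP[_ e32] /andP[e30 _] [D02 D13]] := sq.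
  have deg1 x : e v1 x = (x == v0) || (x == v2).
    apply/idP/orP => [ev|[]/eqP-> //].
    have := triv1 x; rewrite off_squareE // ev negbK => /andP[_].
    rewrite !inE; case/or4P=> /eqP xE; move: ev; rewrite xE ?eqxx ?e_irr; auto.
    by move/(dist_edge e_irr e_conn); rewrite D13.
  have deg3 x : e v3 x = (x == v0) || (x == v2).
    apply/idP/orP => [ev|[]/eqP-> //].
    have := triv3 x; rewrite off_squareE // ev negbK => /andP[_].
    rewrite !inE; case/or4P=> /eqP xE; move: ev; rewrite xE ?eqxx ?e_irr; auto.
    by move/(dist_edge e_irr e_conn); rewrite dS D13.
  apply: (src_square_theta e_sym e_irr e_conn sq deg1 deg3).
  apply: connect_sub conn => x y oxy; apply: connect1; have [exy _] := andP oxy.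
  have inn z w : off_cycle e c z w -> z \notin [:: v1; v3].
    move=> ozw; rewrite !inE negb_or; apply/andP; split; apply: contraTneq ozw => -> //.
  by rewrite /= exy (inn x y) // (inn y x) // off_cycle_sym.
have [|[p0 ray0]] := hang0_extend e_sym e_irr e_conn cc sq triv1 triv3 nconn; first by left.
have /and3P[_ uc _] := cc; pose c2 := [:: v2; v3; v0; v1].
have offE : off_cycle e c2 = off_cycle e c.
  by rewrite /off_cycle -[c2]/(rot 2 c) cycle_edges_rot.
have cc2 : graph_cycle e c2 by rewrite -[c2]/(rot 2 c) graph_cycle_rot.
have sq2 := square_rot e_sym e_conn (square_rot e_sym e_conn sq).
have nconn2 : ~~ connect (off_cycle e c2) v2 v0.
  by rewrite offE (sym_connect_sym (off_cycle_sym e_sym _ _ _ _)).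
have := hang0_extend e_sym e_irr e_conn cc2 sq2 _ _ nconn2; rewrite offE.
case=> // [|[p2 ray2]]; first by left.
by right; apply: (square_rays_class e_sym e_irr e_conn cc sq triv1 triv3 nconn ray0 ray2).
Qed.

Lemma square_adjacent_case v0 v1 v2 v3 (c := [:: v0; v1; v2; v3]) :
    graph_cycle e c -> square e v0 v1 v2 v3 ->
    nontrivial_tree e c v0 -> nontrivial_tree e c v1 ->
  src e + 3 <= #|E|.
Proof.
move=> cc sq /(nontrivial_treeP e_irr)[y oy] /(nontrivial_treeP e_irr)[z oz].
have v0c : v0 \in c by rewrite inE eqxx.
have v1c : v1 \in c by rewrite !inE eqxx orbT.
have /andP[ey] := off_square_out cc sq v0c oy.
have /andP[ez] := off_square_out cc sq v1c oz.
rewrite !inE !negb_or => /and4P[/eqP z0 _ /eqP z2 _] /and4P[_ /eqP y1 _ /eqP y3].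
by apply: (src_square_adjacent e_sym e_irr e_conn sq (u := y) (w := z)); rewrite // e_sym.
Qed.

(** If no two adjacent trees are nontrivial, then the trees at two opposite vertices are trivial. *)
Lemma square_case v0 v1 v2 v3 (c := [:: v0; v1; v2; v3]) :
    graph_cycle e c -> square e v0 v1 v2 v3 ->
    (forall c', graph_cycle e c' -> 4 <= size c') ->
  src e + 3 <= #|E| \/ class_G2 e \/ class_G3 e.
Proof.
move=> cc sq c_min; have /and3P[_ uc _] := cc.
have sqr := square_rot e_sym e_conn; have sq1 := sqr _ _ _ _ sq.
have sq2 := sqr _ _ _ _ sq1; have sq3 := sqr _ _ _ _ sq2.
have ccr k : graph_cycle e (rot k c) by rewrite graph_cycle_rot.
have ntr k v : nontrivial_tree e (rot k c) v = nontrivial_tree e c v.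
  exact: nontrivial_tree_rot.
have adj1 := square_adjacent_case (ccr 1) sq1; have adj2 := square_adjacent_case (ccr 2) sq2.
have adj3 := square_adjacent_case (ccr 3) sq3; have adj0 := square_adjacent_case cc sq.
have case1 := square_trivial_case (ccr 1) sq1 c_min; have case0 := square_trivial_case cc sq c_min.
rewrite !(ntr 1) in adj1 case1; rewrite !(ntr 2) in adj2; rewrite !(ntr 3) in adj3.
move: adj0 adj1 adj2 adj3 case0 case1.
case: (nontrivial_tree e c v0); case: (nontrivial_tree e c v1);
case: (nontrivial_tree e c v2); case: (nontrivial_tree e c v3) => /= a0 a1 a2 a3 b0 b1;
  first [exact: b0 | exact: b1 | by left; auto].
Qed.

Lemma pentagon_case c x0 : graph_cycle e c -> size c = 5 ->
    (forall c', graph_cycle e c' -> 5 <= size c') -> x0 \notin c ->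
  src e + 3 <= #|E|.
Proof.
move=> cc sz c_min x0c; have [z zc] : exists z, z \in c.
  by case: c cc {sz c_min x0c} => // z c; exists z; apply: mem_head.
have /connectP[p pp lp] := e_conn z x0.
have [|a [b [eab ac bc]]] := path_crossing (Q := mem c) pp zc; first by rewrite -lp.
have {}bc : b \notin c by [].
have [k s Es] := rot_to ac.
move: cc bc sz; rewrite -(mem_rot k) -(graph_cycle_rot e k) -(size_rot k) Es => cc bc sz.
have geo : {in a :: s &, forall x y, exists p, [/\ path e x p, last x p = y & size p = d x y]}.
  by move=> x y _ _; apply: dist_path.
rewrite -sz in c_min.
have D i := cyc_dist e_sym e_conn e_sym (fun _ _ => id) a cc c_min geo i.
have ed i := cyc_edge a cc i.
case: s cc bc sz c_min geo D ed {Es} => [|v1 [|v2 [|v3 [|v4 [|? ?]]]]] // cc bc sz c_min geo D ed.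
apply: (@src_pentagon_pendant _ _ e_sym e_irr e_conn a v1 v2 v3 v4 b) => //.
- exact: (ed 0).
- exact: (ed 1).
- exact: (ed 2).
- exact: (ed 3).
- exact: (ed 4).
- by split; [exact: (D 0 2) | exact: (D 1 2) | exact: (D 2 2) | exact: (D 3 2) | exact: (D 4 2)].
by rewrite e_sym.
Qed.

(** The cycle is isometric, so vertices at distance 1 are consecutive on it and there are no
    chords. *)
Lemma spanning_cycle c : graph_cycle e c -> (forall x, x \in c) ->
    (forall c', graph_cycle e c' -> size c <= size c') ->
  edge_set e = cycle_edges c.
Proof.
move=> cc call c_min; apply/eqP; rewrite eqEsubset cycle_edges_sub_edge_set // andbT.
have geo : {in c &, forall x y, exists p, [/\ path e x p, last x p = y & size p = d x y]}.
  by move=> x y _ _; apply: dist_path.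
apply/subsetP => f /edge_setP[x [y [exy ->]]].
have x0 := x; have [i lt_i xi] := cycP x0 (call x); have [j lt_j yj] := cycP x0 (call y).
wlog ij : x y i j exy lt_i lt_j xi yj / i <= j => [hw|].
  have [/hw|/ltnW/hw] := leqP i j; first exact.
  by rewrite setUC; apply; rewrite // e_sym.
have le_ji : j - i <= size c by lia.
have := cyc_dist e_sym e_conn e_sym (fun _ _ => id) x0 cc c_min geo i le_ji.
rewrite subnKC // xi yj (dist_edge e_irr e_conn exy) => D.
have [ji|[i0 jn]] : j = i.+1 \/ i = 0 /\ j.+1 = size c by move: D lt_j ij; clear; lia.
  by apply/(cycle_edgesP x0 _ cc); exists i; rewrite // -ji xi yj.
apply/(cycle_edgesP x0 _ cc); exists j; rewrite // jn -[size c]add0n cyc_add -i0 xi yj.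
by rewrite setUC.
Qed.

Lemma src_or_class : (exists c, graph_cycle e c) ->
  src e + 3 <= #|E| \/ [\/ cycle_graph e 5, class_G1 e, class_G2 e | class_G3 e].
Proof.
case/shortest_cycle => c cc c_min; have x0 : T by case: c cc {c_min}.
have geo : {in c &, forall x y, exists p, [/\ path e x p, last x p = y & size p = d x y]}.
  by move=> x y _ _; apply: dist_path.
have D i := cyc_dist e_sym e_conn e_sym (fun _ _ => id) x0 cc c_min geo i.
have [n3 _ _] := and3P cc; have := src_cycle e_sym e_irr e_conn cc c_min.
have [n6|lt6] := leqP 6 (size c).
  by move=> le_E; left; apply: leq_trans le_E; rewrite leq_add2l; lia.
move=> _; case: c cc c_min geo D n3 lt6 => [|v0 [|v1 [|v2 s]]] // cc c_min geo D _ lt6.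
have e01 := cyc_edge x0 cc 0; have e12 := cyc_edge x0 cc 1; have e23 := cyc_edge x0 cc 2.
case: s cc c_min geo D lt6 e01 e12 e23 => [|v3 [|v4 [|? ?]]] // cc c_min geo D _ e01 e12 e23.
- have [|?] := triangle_case e01 e12 e23; first by left.
  by right; constructor 2.
- have e30 := cyc_edge x0 cc 3.
  have sq : square e v0 v1 v2 v3.
    have eC x y : e x y -> e x y && e y x by move=> exy; rewrite exy e_sym.
    by split; [exact: eC e01 | exact: eC e12 | exact: eC e23 | exact: eC e30
             | split; [exact: (D 0 2) | exact: (D 1 2)]].
  by case: (square_case cc sq c_min) => [|[?|?]];
    [left | right; constructor 3 | right; constructor 4].
have [[x /pentagon_case]|call] := classic (exists x, x \notin [:: v0; v1; v2; v3; v4]).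
  by move=> h; left; apply: h c_min.
right; constructor 1; exists [:: v0; v1; v2; v3; v4].
have {}call x : x \in [:: v0; v1; v2; v3; v4].
  by apply/negPn/negP => xc; apply: call; exists x.
by split=> //; apply: spanning_cycle.
Qed.

End Cases.

(** * Lower bounds for trees, the 5-cycle and the three classes *)

Section Classes.
Variables (T : finType) (e : rel T).
Hypotheses (e_sym : symmetric e) (e_irr : irreflexive e) (e_conn : connected e).
Local Notation d := (dist e).
Local Notation E := (edge_set e).

Lemma tree_src : tree e -> #|E| <= src e.
Proof.
case=> _ acyc; apply: (src_ge_acyclic e_sym e_irr e_conn (fun _ _ => id) e_sym acyc).
by move=> x x' y y' w _ _ [].
Qed.

(** Vertices two steps apart have only one common neighbor, so their geodesic is unique and
    consecutive edges differ in color. Two colors would have to alternate around a cycle of odd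
    length. *)
Lemma cycle_graph5_src : cycle_graph e 5 -> #|E| <= src e + 2.
Proof.
case=> c [cc sz _ EE]; rewrite EE (card_cycle_edges cc) sz.
rewrite leqNgt addn2 !ltnS; apply/negP => src2.
have x0 : T by case: c cc {sz EE}.
pose v := cyc c x0; have ev i : e (v i) (v i.+1) := cyc_edge x0 cc i.
have v5 i : v (i + 5) = v i by rewrite -sz; apply: cyc_add.
have vk i k : 0 < k < 5 -> v (i + k) <> v i.
  move=> k5 /(cyc_inj_mod cc)/eqP; rewrite sz -{2}[i]addn0 eqn_modDl !modn_small //; last first.
    by case/andP: k5.
  by case: k k5.
have vadd i j k : v i = v j -> v (i + k) = v (j + k).
  by move=> vij; elim: k => [|k IH]; rewrite ?addn0 // !addnS /v -!(cyc_next x0 cc) -/v IH.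
have nbr i y : e (v i) y -> y = v (i + 1) \/ y = v (i + 4).
  move=> ey; have : [set v i; y] \in cycle_edges c by rewrite -EE mem_edge_set.
  case/(cycle_edgesP x0 _ cc) => j lt_j /set2_inj[[/(vadd _ _ 1) vij ->]|[/(vadd _ _ 4) vij ->]].
    by left; rewrite vij addn1.
  by right; rewrite vij addSnnS v5.
have edE i : [set v i; v i.+1] \in E by rewrite mem_edge_set.
have /existsP[col /forallP rb] := src_colorable e_irr e_conn.
pose g i : nat := col (exist (fun A => A \in E) _ (edE i)).
have g_per i : g (i + 5) = g i.
  by congr (nat_of_ord (col _)); apply: val_inj; rewrite /= -addSn !v5.
have g_adj i : g i != g i.+1.
  have ne02 : ~~ e (v i) (v i.+2).
    apply/negP => /nbr[E1|E1].
      by case: (@vk (i + 1) 1 isT); rewrite -E1; congr v; clear; lia.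
    by case: (@vk i.+2 2 isT); rewrite E1; congr v; clear; lia.
  have n02 : v i != v i.+2 by apply/eqP => /esym; rewrite -addn2; apply: vk.
  have d02 : d (v i) (v i.+2) = 2.
    apply/eqP; rewrite eqn_leq dist_gt1 // andbT.
    by have := @dist_le_path _ e (v i) [:: v i.+1; v i.+2]; rewrite /= !ev; apply.
  apply/eqP => /val_inj gi; have /forallP/(_ (v i.+2)) := rb (v i).
  case/has_rainbow_geodesicP => // w [[w0 w2 we] inj]; rewrite d02 in w2 we inj.
  have := we 0 isT; have := we 1 isT; rewrite w0 w2 e_sym => /nbr e1 /nbr e0.
  suff w1 : w 1 = v i.+1.
    by have := inj 0 1 _ _ isT isT _ _ gi; rewrite /edge_at w0 w1 w2 /= => /(_ erefl erefl).
  case: e0 => [->|w1]; first by rewrite addn1.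
  case: e1 => [w1'|->]; last by rewrite (_ : i.+2 + 4 = i.+1 + 5) ?v5 // !addSnnS.
  have := @vk (i + 3) 1 isT; rewrite -addnA -w1 w1' => /(_ _)[].
  by congr v; clear; lia.
have gb i : g i < 2 by apply: leq_trans src2; rewrite ltn_ord.
move: (gb 0) (gb 1) (gb 2) (gb 3) (gb 4) (g_adj 0) (g_adj 1) (g_adj 2) (g_adj 3) (g_adj 4).
rewrite (g_per 0); move: (g 0) (g 1) (g 2) (g 3) (g 4); clear.
by case=> [|[|?]] // [|[|?]] // [|[|?]] // [|[|?]] // [|[|?]].
Qed.

Lemma hanging_path_rot k c v : uniq c -> hanging_path e c v -> hanging_path e (rot k c) v.
Proof.
by move=> uc; rewrite /hanging_path /hanging_tree /off_cycle cycle_edges_rot.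
Qed.

(** The path of length 0 lets both classes of 4-cycles be treated alike. *)
Lemma trivial_hanging_path c v : ~~ nontrivial_tree e c v -> hanging_path e c v.
Proof.
move=> tv; have iso y : ~~ off_cycle e c v y.
  by apply: contra tv => o; apply/(nontrivial_treeP e_irr); exists y.
have mem x : (x \in hanging_tree e c v) = (x == v).
  rewrite inE; apply/idP/eqP => [/(connect_isolated iso) //|->]; exact: connect0.
exists [::]; split=> // [x|x y]; first by rewrite mem inE.
by rewrite !mem => /eqP -> /eqP ->; apply: negbTE.
Qed.

(** Uniqueness of the cycle is used twice: a chord would create a triangle, and a path off the cycle
    from [v0] to [v2] would close up through [v1], which it avoids because the tree at [v1] is
    trivial. *)
Lemma unicyclic_square_src v0 v1 v2 v3 (c := [:: v0; v1; v2; v3]) :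
    unicyclic_with e c -> ~~ nontrivial_tree e c v1 -> ~~ nontrivial_tree e c v3 ->
    hanging_path e c v0 -> hanging_path e c v2 ->
  #|E| <= src e + 2.
Proof.
case=> _ cc uni t1 t3 /hanging_path_full_ray[p0 ray0] /hanging_path_full_ray[p2 ray2].
have dS := dist_sym e_sym e_conn.
have /and3P[_ + /and5P[e01 e12 e23 e30 _]] := cc.
rewrite /= !inE !negb_or -!andbA => /and5P[n01 n02 n03 n12 /and3P[n13 n23 _]].
have triangle a b c' : e a b -> e b c' -> e c' a -> a != b -> b != c' -> a != c' -> False.
  move=> ab bc ca nab nbc nac; have cc' : graph_cycle e [:: a; b; c'].
    by apply/and3P; split; rewrite //= ?inE ?negb_or ?nab ?nac ?nbc ?ab ?bc ?ca.
  by have := card_cycle_edges cc'; rewrite (uni _ cc') (card_cycle_edges cc).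
have D2 a b c' : e a b -> e b c' -> a != b -> b != c' -> a != c' -> d a c' = 2.
  move=> ab bc nab nbc nac; apply/eqP; rewrite eqn_leq dist_gt1 // ?andbT.
    by have := @dist_le_path _ e a [:: b; c']; rewrite /= ab bc; apply.
  by apply/negP => ac; apply: (triangle a b c') => //; rewrite e_sym.
have sq : square e v0 v1 v2 v3.
  have eC x y : e x y -> e x y && e y x by move=> exy; rewrite exy e_sym.
  by split; try exact: eC; split; [apply: D2 e01 e12 _ _ _ | apply: D2 e12 e23 _ _ _].
have triv u y : ~~ nontrivial_tree e c u -> ~~ off_cycle e c u y.
  by apply: contra => o; apply/(nontrivial_treeP e_irr); exists y.
have triv1 y := triv v1 y t1; have triv3 y := triv v3 y t3.
have off_sym := off_cycle_sym e_sym v0 v1 v2 v3.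
suff nconn : ~~ connect (off_cycle e c) v0 v2.
  exact: (square_rays_src e_sym e_irr e_conn cc sq triv1 triv3 nconn ray0 ray2).
apply/negP => /connectP[q /shortenP[p pp up _] lp].
have v1p : v1 \notin v0 :: p.
  rewrite inE negb_or eq_sym n01 /=; apply/negP => /splitPr p_split.
  case: p_split pp => s1 s2; rewrite cat_path /= => /and3P[_ o _].
  by move: o; rewrite off_sym (negbTE (triv1 _)).
case: p pp up lp v1p => [_ _ /= v20|a p pp up lp v1p]; first by rewrite v20 eqxx in n02.
have cc' : graph_cycle e [:: v1, v0, a & p].
  apply/and3P; split=> //; first by rewrite cons_uniq v1p.
  have /andP[e0a pa] : e v0 a && path e a p.
    by apply: (sub_path _ pp : is_true (path e v0 (a :: p))) => x y /andP[].
  rewrite /= in lp; by rewrite /= rcons_path -lp e_sym e01 e0a pa e_sym e12.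
have : [set v0; a] \in cycle_edges [:: v1, v0, a & p].
  apply/imsetP; exists v0; first by rewrite !inE eqxx orbT.
  by rewrite /= (negbTE n01) eqxx.
by rewrite (uni _ cc'); case/andP: pp => /andP[_ /negbTE ->].
Qed.

Lemma class_G2_src : class_G2 e -> #|E| <= src e + 2.
Proof.
case=> c [uni sz [u [v [[uc vc uv nuv] _ [hu hv] triv]]]].
have [_ cc _] := uni; have /and3P[_ uniq_c _] := cc.
have [k s Es] := rot_to uc.
move: uni cc sz vc nuv hu hv triv => /(unicyclic_with_rot k) uni.
rewrite -(graph_cycle_rot e k) -(size_rot k) -(mem_rot k) -(cycle_edges_rot k) //.
move=> cc sz vc nuv.
move=> /(hanging_path_rot k uniq_c) hu /(hanging_path_rot k uniq_c) hv triv.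
have {}triv w : w \in rot k c -> w != u -> w != v -> ~~ nontrivial_tree e (rot k c) w.
  by rewrite mem_rot nontrivial_tree_rot //; apply: triv.
rewrite {c uc uniq_c}Es in uni cc sz vc nuv hu hv triv.
case: s uni cc sz vc nuv hu hv triv => [|a [|b [|f [|? ?]]]] // uni cc _ vc nuv hu hv triv.
move: nuv; rewrite (cycle_edges4 cc) !in_setU !in_set1 !negb_or.
case/andP=> /andP[/andP[nua _] _] nuf.
have vb : v = b.
  move: vc; rewrite !inE eq_sym (negbTE uv) /= => /or3P[]/eqP vE //.
    by rewrite vE eqxx in nua.
  by rewrite vE setUC eqxx in nuf.
rewrite {v vc uv nua nuf}vb in hv triv.
have /and3P[_ + _] := cc; rewrite /= !inE !negb_or -!andbA.
case/and5P=> nua nub nuf nab /and3P[naf nbf _].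
apply: (unicyclic_square_src uni) => //; apply: triv; rewrite ?inE ?eqxx ?orbT // eq_sym //.
Qed.

Lemma class_G3_src : class_G3 e -> #|E| <= src e + 2.
Proof.
case=> c [uni sz le1 hp]; have [_ cc _] := uni; have /and3P[_ uc _] := cc.
have {}hp v : v \in c -> hanging_path e c v.
  move=> vc; have [/hp|/trivial_hanging_path //] := boolP (nontrivial_tree e c v); exact.
have [u uc' triv] : exists2 u, u \in c & forall w, w \in c -> w != u -> ~~ nontrivial_tree e c w.
  (* If all trees are trivial, any vertex of the cycle serves as [u]. *)
  have [[u [uc' tu]]|none] := classic (exists u, u \in c /\ nontrivial_tree e c u); last first.
    case: c {uni cc uc le1 hp} sz none => // u c _ none; exists u; first exact: mem_head.
    by move=> w wc _; apply/negP => tw; apply: none; exists w.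
  exists u => // w wc wu; apply/negP => tw; case/negP: wu; apply/eqP.
  by apply: (card_le1_eqP le1); rewrite inE ?wc ?uc'.
have [k s Es] := rot_to uc'.
have {}triv w : w \in rot k c -> w != u -> ~~ nontrivial_tree e (rot k c) w.
  by rewrite mem_rot nontrivial_tree_rot //; apply: triv.
have {}hp w : w \in rot k c -> hanging_path e (rot k c) w.
  by rewrite mem_rot => /hp; apply: hanging_path_rot.
move: uni cc sz => /(unicyclic_with_rot k) uni.
rewrite -(graph_cycle_rot e k) -(size_rot k) => cc sz.
rewrite {c uc uc' le1}Es in uni cc sz triv hp.
case: s uni cc sz triv hp => [|a [|b [|f [|? ?]]]] // uni cc _ triv hp.
have /and3P[_ + _] := cc; rewrite /= !inE !negb_or -!andbA.
case/and5P=> nua nub nuf nab _.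
apply: (unicyclic_square_src uni); first [apply: triv | apply: hp];
  by rewrite ?inE ?eqxx ?orbT // eq_sym.
Qed.

End Classes.

Theorem theorem3p1 (T : finType) (e : rel T)
  (e_sym : symmetric e) (e_irr : irreflexive e)
  (e_conn : connected e) (T_nontrivial : 1 < #|T|) :
  (src e + 2 <= #|edge_set e| <-> ~ tree e)
  /\ (src e + 2 = #|edge_set e| <->
      [\/ cycle_graph e 5, class_G1 e, class_G2 e | class_G3 e]).
Proof.
have cycle_src : (exists c, graph_cycle e c) -> src e + 2 <= #|edge_set e|.
  case/shortest_cycle => c cc /(src_cycle e_sym e_irr e_conn cc); apply: leq_trans.
  by rewrite leq_add2l leq_maxl.
have tree_lt : src e + 2 <= #|edge_set e| -> ~ tree e.
  by move=> + /(tree_src e_sym e_irr e_conn); lia.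
have not_tree : ~ tree e -> exists c, graph_cycle e c.
  by move=> nt; apply: NNPP => acyc; apply: nt.
split; first by split=> [/tree_lt //|/not_tree/cycle_src].
split=> [E|cls].
  have /tree_lt/not_tree/(src_or_class e_sym e_irr e_conn)[] // : src e + 2 <= #|edge_set e|.
    by rewrite E.
  by rewrite -E leq_add2l.
apply/eqP; rewrite eqn_leq; apply/andP; split.
  by apply: cycle_src; case: cls => -[c] => [[cc]|[[]]|[[]]|[[]]]; exists c.
case: cls.
- exact: cycle_graph5_src.
- exact: class_G1_src.
- exact: class_G2_src.
exact: class_G3_src.
Qed.
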